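(* Let $K\ge 2$, let $\mathcal{X}_1,\dots,\mathcal{X}_K$ be Euclidean vector spaces, and let $X=(X_1,\dots,X_K)$ be a random vector with values in $\mathcal{X}=\mathcal{X}_1\times\cdots\times\mathcal{X}_K$, $q=\dim\mathcal{X}$, and distribution $\mathbb{P}_X$. Assume that for all $k\in\{1,\dots,K\}$ one has $\mathbb{E}(X_k)=0$, $\mathbb{E}(\Vert X_k\Vert_k^2)<+\infty$ and $V_k=I_k$ (the identity operator of $\mathcal{X}_k$). Then for any $x=(x_1,\dots,x_K)\in\mathcal{X}$ and any $j\in\{1,\dots,q\}$: (i) the influence function of $\mathbb{R}_j$ at $\mathbb{P}_X$ is $$\mathrm{IF}(x;\rho_j,\mathbb{P}_X)=\sum_{k=1}^K\sum_{\substack{\ell=1\\ \ell\ne k}}^K\langle\beta_k^{(j)},x_k\rangle_k\,\langle x_\ell-V_{\ell k}x_k,\beta_\ell^{(j)}\rangle_\ell .$$ (ii) If, in addition, $\rho_1>\rho_2>\cdots>\rho_q$, then the influence function of $\mathbb{A}_j$ at $\mathbb{P}_X$ is $$\begin{aligned}\mathrm{IF}(x;\alpha^{(j)},\mathbb{P}_X)=&\sum_{k=1}^K\sum_{\substack{\ell=1\\ \ell\ne k}}^K\sum_{\substack{m=1\\ m\ne j}}^q\frac{1}{\rho_j-\rho_m}\Big(\langle\beta_k^{(m)},x_k\rangle_k\langle x_\ell,\beta_\ell^{(j)}\rangle_\ell-\tfrac12\langle\beta_k^{(m)},x_k\rangle_k\langle x_k,V_{k\ell}\beta_\ell^{(j)}\rangle_k\\&-\tfrac12\langle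 x_k,V_{k\ell}\beta_\ell^{(m)}\rangle_k\langle x_k,\beta_k^{(j)}\rangle_k\Big)\beta^{(m)}\\&-\tfrac12\Big(\sum_{k=1}^K\big[\tau_k^*(x_k\otimes x_k)\tau_k+\langle\beta_k^{(j)},x_k\rangle_k^2\,\mathbb{I}\big]-2\,\mathbb{I}\Big)\beta^{(j)},\end{aligned}$$ where $\mathbb{I}$ is the identity operator of $\mathcal{X}$.
   Context: Euclidean vector spaces are finite-dimensional real inner product spaces; $\langle\cdot,\cdot\rangle_k$, $\Vert\cdot\Vert_k$ are the inner product and norm of $\mathcal{X}_k$, and $\mathcal{X}$ carries $\langle\alpha,\beta\rangle_{\mathcal{X}}=\sum_k\langle\alpha_k,\beta_k\rangle_k$; a subscript $k$ on a vector of $\mathcal{X}$ denotes its component in $\mathcal{X}_k$. The tensor product $x\otimes y$ is the linear map $h\mapsto\langle x,h\rangle y$; $A^*$ is the adjoint of $A$. $\tau_k:\mathcal{X}\to\mathcal{X}_k$, $\alpha\mapsto\alpha_k$, is the canonical projection, with adjoint $\tau_k^*:t\mapsto(0,\dots,0,t,0,\dots,0)$. $V_{k\ell}=\mathbb{E}(X_\ell\otimes X_k)$, $V_k=V_{kk}$. $\mathcal{L}(\mathcal{X})$ is the space of linear maps from $\mathcal{X}$ to itself, and $f,g:\mathcal{L}(\mathcal{X})\to\mathcal{L}(\mathcal{X})$ are $$f(A)=\sum_{k=1}^K\tau_k^*\tau_kA\tau_k^*\tau_k,\qquad g(A)=\sum_{k=1}^K\sum_{\ell\ne k}\tau_k^*\tau_kA\tau_\ell^*\tau_\ell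 .$$ For a probability measure $\mathbb{P}$ on $\mathcal{X}$ let $\mathbb{V}(\mathbb{P})=\int x\otimes x\,d\mathbb{P}(x)-\big(\int x\,d\mathbb{P}(x)\big)\otimes\big(\int x\,d\mathbb{P}(x)\big)$ and $\mathbb{T}(\mathbb{P})=f(\mathbb{V}(\mathbb{P}))^{-1/2}g(\mathbb{V}(\mathbb{P}))f(\mathbb{V}(\mathbb{P}))^{-1/2}$; $T=\mathbb{T}(\mathbb{P}_X)$. Let $\rho_1\ge\cdots\ge\rho_q$ be the eigenvalues of $T$ and $\{\beta^{(1)},\dots,\beta^{(q)}\}$ an orthonormal basis of $\mathcal{X}$ such that $\beta^{(j)}$ is an eigenvector of $T$ associated with $\rho_j$; $\alpha^{(j)}=f(\mathbb{V}(\mathbb{P}_X))^{-1/2}\beta^{(j)}$. $\mathbb{R}_j(\mathbb{P})$ denotes the $j$-th largest eigenvalue of $\mathbb{T}(\mathbb{P})$, $\mathbb{B}_j(\mathbb{P})$ the associated eigenvector, and $\mathbb{A}_j(\mathbb{P})=f(\mathbb{V}(\mathbb{P}))^{-1/2}\mathbb{B}_j(\mathbb{P})$, so that $\mathbb{R}_j(\mathbb{P}_X)=\rho_j$, $\mathbb{B}_j(\mathbb{P}_X)=\beta^{(j)}$, $\mathbb{A}_j(\mathbb{P}_X)=\alpha^{(j)}$. The influence function of a functional $S$ at $\mathbb{P}$ is $\mathrm{IF}(x;S,\mathbb{P})=\lim_{\varepsilon\downarrow0}\varepsilon^{-1}\big(S((1-\varepsilon)\mathbb{P}+\varepsilon\delta_x)-S(\mathbb{P})\big)$,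 with $\delta_x$ the Dirac measure at $x$; $\mathrm{IF}(x;\rho_j,\mathbb{P}_X)$ and $\mathrm{IF}(x;\alpha^{(j)},\mathbb{P}_X)$ mean the influence functions of $\mathbb{R}_j$ and $\mathbb{A}_j$.
   Formalization: (i) assumes ρ_j simple or 𝔹_j continuous at P_X along the contamination at x (false for general multiple eigenvalues); 𝔹_j(P) is scaled by ⟨𝔹_j(P), f(𝕍(P))𝔹_j(P)⟩=1 with ⟨𝔹_j(P),β^(j)⟩≥0, since with unit norm the formula in (ii) is false. *)

(* Defs.v *)
From HB Require Import structures.
From mathcomp Require Import all_boot all_order all_algebra.
From mathcomp Require Import all_classical all_reals all_analysis.

Set Implicit Arguments.
Unset Strict Implicit.
Unset Printing Implicit Defensive.

Import Order.TTheory GRing.Theory Num.Theory.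
Import numFieldNormedType.Exports.

Local Open Scope classical_set_scope.
Local Open Scope ring_scope.

HB.mixin Record Vector_isEuclidean (R : realType) V of Vector R V :=
  { ip : {dot V for (@idfun R)} }.

#[short(type="euclidType")]
HB.structure Definition Euclidean (R : realType) :=
  { V of Vector R V & Vector_isEuclidean R V }.

Arguments ip {R s}.

Section EuclideanOperators.
Context {R : realType}.
Implicit Types U V : euclidType R.

Definition enorm V (u : V) : R := Num.sqrt (ip u u).

Definition tensor U V (x : U) (y : V) : 'Hom(U, V) :=
  linfun (fun h : U => ip x h *: y).

Definition selfadjoint V (A : 'End(V)) : Prop :=
  forall u v : V, ip (A u) v = ip u (A v).

Definition nonneg_op V (A : 'End(V)) : Prop :=
  selfadjoint A /\ forall u : V, 0 <= ip (A u) u.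

(* Uniquely determined when A is self-adjoint and positive definite; 0 when no
   such operator exists. *)
Definition invsqrt V (A : 'End(V)) : 'End(V) :=
  xget 0 [set S : 'End(V) | nonneg_op S /\ (S \o S \o A)%VF = \1%VF].

(* For a self-adjoint A the geometric multiplicities add up to the dimension,
   so exactly one sequence has this property. *)
Definition eigenvalue_seq V (A : 'End(V)) (s : seq R) : Prop :=
  sorted >=%R s /\ forall a : R, count_mem a s = \dim (passmx.leigenspace A a).

Definition eigenvalues V (A : 'End(V)) : seq R :=
  xget [::] [set s | eigenvalue_seq A s].

End EuclideanOperators.

Section VectorIntegral.
Context {R : realType} d {T : measurableType d} (P : probability T R).

(* Coordinatewise integral; the value does not depend on the basis as soon as
   the coordinates are integrable. *)
Definition vexp (W : vectType R) (phi : T -> W) : W :=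
  \sum_(i < \dim {:W})
     (\int[P]_w coord (vbasis {:W}) i (phi w)) *: (vbasis {:W})`_i.

End VectorIntegral.

Section Product.
Context {R : realType} {K : nat}.
Variable E : 'I_K -> euclidType R.

Definition eprod : Type := {dffun forall k : 'I_K, E k}.

Definition ecomp (x : eprod) (k : 'I_K) : E k := (x : {dffun _}) k.
Definition emk (f : forall k, E k) : eprod := finfun f.

HB.instance Definition _ := Choice.on eprod.

Lemma ecompE f k : ecomp (emk f) k = f k. Proof. exact: ffunE. Qed.

Lemma eprodP (x y : eprod) : (forall k, ecomp x k = ecomp y k) -> x = y.
Proof. by move=> xy; apply/ffunP. Qed.

Definition eprod_zero := emk (fun k => 0).
Definition eprod_opp (x : eprod) := emk (fun k => - ecomp x k).
Definition eprod_add (x y : eprod) := emk (fun k => ecomp x k + ecomp y k).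
Definition eprod_scale (a : R) (x : eprod) := emk (fun k => a *: ecomp x k).

Fact eprod_addA : associative eprod_add.
Proof. by move=> x y z; apply: eprodP => k; rewrite !ecompE addrA. Qed.
Fact eprod_addC : commutative eprod_add.
Proof. by move=> x y; apply: eprodP => k; rewrite !ecompE addrC. Qed.
Fact eprod_add0 : left_id eprod_zero eprod_add.
Proof. by move=> x; apply: eprodP => k; rewrite !ecompE add0r. Qed.
Fact eprod_addN : left_inverse eprod_zero eprod_opp eprod_add.
Proof. by move=> x; apply: eprodP => k; rewrite !ecompE addNr. Qed.

HB.instance Definition _ := GRing.isZmodule.Build eprod
  eprod_addA eprod_addC eprod_add0 eprod_addN.

Fact eprod_scaleA a b (x : eprod) :
  eprod_scale a (eprod_scale b x) = eprod_scale (a * b) x.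
Proof. by apply: eprodP => k; rewrite !ecompE scalerA. Qed.
Fact eprod_scale1 : left_id 1 eprod_scale.
Proof. by move=> x; apply: eprodP => k; rewrite !ecompE scale1r. Qed.
Fact eprod_scaleDr : right_distributive eprod_scale +%R.
Proof. by move=> a x y; apply: eprodP => k; rewrite !ecompE scalerDr. Qed.
Fact eprod_scaleDl (x : eprod) : {morph eprod_scale^~ x : a b / a + b}.
Proof. by move=> a b; apply: eprodP => k; rewrite !ecompE scalerDl. Qed.

HB.instance Definition _ := GRing.Zmodule_isLmodule.Build R eprod
  eprod_scaleA eprod_scale1 eprod_scaleDr eprod_scaleDl.

Lemma ecompD x y k : ecomp (x + y) k = ecomp x k + ecomp y k.
Proof. exact: ecompE. Qed.
Lemma ecompZ a x k : ecomp (a *: x) k = a *: ecomp x k.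
Proof. exact: ecompE. Qed.

Import VectorInternalTheory.

Fact eprod_vect_iso : Vector.axiom (\sum_k dim (E k)) eprod.
Proof.
exists (fun x => \mxrow_k v2r (ecomp x k)).
  move=> a x y; apply/mxrowP => k.
  rewrite submxrowD !mxrowK ecompD ecompZ linearP; congr (_ + _).
  transitivity (a *: submxrow (\mxrow_k v2r (ecomp x k)) k).
    by rewrite mxrowK.
  by apply/matrixP => i j; rewrite !mxE.
exists (fun r => emk (fun k => r2v (submxrow r k))).
  by move=> x; apply: eprodP => k;
     rewrite ecompE mxrowK v2rK.
move=> r; apply/mxrowP => k.
by rewrite mxrowK ecompE r2vK.
Qed.

HB.instance Definition _ := Lmodule_hasFinDim.Build R eprod eprod_vect_iso.

Definition eprod_ip (x y : eprod) : R := \sum_k ip (ecomp x k) (ecomp y k).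

Fact eprod_ip_bilinear : bilinear_for *%R (@idfun R \; *%R) eprod_ip.
Proof.
split=> [u a x y|u a x y]; rewrite /eprod_ip /= mulr_sumr -big_split /=;
  apply: eq_bigr => k _; rewrite ecompD ecompZ.
  by rewrite linearDl linearZl_LR.
by rewrite linearDr linearZr_LR.
Qed.

HB.instance Definition _ := @bilinear_isBilinear.Build R eprod eprod R
  *%R (@idfun R \; *%R) eprod_ip eprod_ip_bilinear.

Fact eprod_ip_sym (x y : eprod) :
  eprod_ip x y = (-1) ^+ false * idfun (eprod_ip y x).
Proof.
rewrite expr0 mul1r /= /eprod_ip; apply: eq_bigr => k _.
by rewrite hermC expr0 mul1r.
Qed.

HB.instance Definition _ := @isHermitianSesquilinear.Build R eprod
  false (@idfun R) eprod_ip eprod_ip_sym.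

Fact eprod_ip_gt0 (x : eprod) : x != 0 -> 0 < eprod_ip x x.
Proof.
move=> x0; have ge0 k : 0 <= ip (ecomp x k) (ecomp x k).
  have [->|] := eqVneq (ecomp x k) 0; first by rewrite linear0l.
  by move=> /neq0_dnorm_gt0 /ltW.
rewrite lt_neqAle sumr_ge0 // andbT eq_sym psumr_eq0 //.
apply: contra x0 => /allP h; apply/eqP/eprodP => k.
have /implyP/(_ isT) := h k (mem_index_enum k).
rewrite [RHS]ecompE; apply: contraTeq => x0.
by rewrite gt_eqF //; exact: neq0_dnorm_gt0.
Qed.

HB.instance Definition _ := @isDotProduct.Build R eprod eprod_ip eprod_ip_gt0.

HB.instance Definition _ := Vector_isEuclidean.Build R eprod
  (eprod_ip : {dot eprod for (@idfun R)}).

End Product.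

Section Borel.
Context {R : realType} {K : nat}.
Variable E : 'I_K -> euclidType R.

Definition eopen : set (set (eprod E)) :=
  [set U | forall x, U x ->
    exists2 r : R, 0 < r & forall y, enorm (y - x) < r -> U y].

HB.instance Definition _ := isPointed.Build (eprod E) 0.

HB.instance Definition _ := @isMeasurable.Build (sigma_display eopen)
  (eprod E) <<s eopen >> (@sigma_algebra0 _ setT eopen)
  (@sigma_algebraC (eprod E) eopen) (@sigma_algebra_bigcup _ setT eopen).

End Borel.

Section Contamination.
Context d {T : measurableType d} {R : realType}.
Variables (P : probability T R) (x : T) (e : R).

Definition clip01 : R := Num.max 0 (Num.min e 1).

Fact clip01_ge0 : 0 <= clip01.
Proof. by rewrite le_max lexx. Qed.

Fact clip01_onem_ge0 : 0 <= 1 - clip01.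
Proof. by rewrite subr_ge0 ge_max ler01 ge_min lexx orbT. Qed.

(* (1 - e) P + e delta_x; e is clipped to [0, 1] so that this is a probability
   for every e, which is immaterial for limits as e decreases to 0. *)
Definition contamination : set T -> \bar R :=
  measure_add (mscale (NngNum clip01_onem_ge0) P)
              (mscale (NngNum clip01_ge0) (@dirac _ T x R)).

HB.instance Definition _ := Measure.on contamination.

Fact contamination_setT : contamination setT = 1%E.
Proof.
rewrite /contamination measure_addE.
transitivity ((1 - clip01)%:E * 1 + clip01%:E * 1)%E; last first.
  by rewrite !mule1 -EFinD subrK.
by congr (_ * _ + _ * _)%E; [exact: probability_setT | exact: diracT].
Qed.

HB.instance Definition _ :=
  Measure_isProbability.Build _ _ _ contamination contamination_setT.

End Contamination.

Section InfluenceFunction.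
Context d {T : measurableType d} {R : realType}.

Definition is_IF_real (x : T) (S : probability T R -> R) (P : probability T R)
    (l : R) : Prop :=
  e^-1 * (S (contamination P x e) - S P) @[e --> 0^'+] --> l.

Definition is_IF (V : euclidType R) (x : T) (S : probability T R -> V)
    (P : probability T R) (l : V) : Prop :=
  enorm (e^-1 *: (S (contamination P x e) - S P) - l) @[e --> 0^'+] --> (0 : R).

End InfluenceFunction.

Section MultipleSetCanonicalAnalysis.
Context {R : realType} {K : nat} {E : 'I_K -> euclidType R}.
Local Notation X := (eprod E).
Implicit Types (A : 'End(X)) (Q : probability X R).

Definition tau k : 'Hom(X, E k) := linfun (fun x : X => ecomp x k).

Definition tau_adj k : 'Hom(E k, X) :=
  linfun (fun t : E k => emk (eqtype.dfwith (fun l => 0 : E l) t)).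

Lemma tauE k (x : X) : tau k x = ecomp x k.
Proof.
pose f (x : X) := ecomp x k.
have lf : linear f by move=> a u v; rewrite /f ecompD ecompZ.
pose F : {linear X -> E k} := HB.pack f (GRing.isLinear.Build _ _ _ _ f lf).
exact: (lfunE F).
Qed.

Lemma tau_adjE k (t : E k) :
  tau_adj k t = emk (eqtype.dfwith (fun l => 0 : E l) t).
Proof.
pose f (t : E k) : X := emk (eqtype.dfwith (fun l => 0 : E l) t).
have lf : linear f.
  move=> a u v; apply: eprodP => l; rewrite ecompD ecompZ !ecompE.
  case: (eqVneq k l) => [<-|kl]; first by rewrite !eqtype.dfwith_in.
  by rewrite !eqtype.dfwith_out // scaler0 addr0.
pose F : {linear E k -> X} := HB.pack f (GRing.isLinear.Build _ _ _ _ f lf).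
exact: (lfunE F).
Qed.

Lemma tau_adjP k (x : X) (t : E k) : ip (tau k x) t = ip x (tau_adj k t).
Proof.
rewrite tauE tau_adjE [RHS](bigD1 k) //= ecompE eqtype.dfwith_in.
rewrite big1 ?addr0 // => l lk.
by rewrite ecompE eqtype.dfwith_out 1?eq_sym // linear0r.
Qed.

Definition fdiag A : 'End(X) :=
  \sum_k (tau_adj k \o tau k \o A \o tau_adj k \o tau k)%VF.

Definition goff A : 'End(X) :=
  \sum_k \sum_(l | l != k) (tau_adj k \o tau k \o A \o tau_adj l \o tau l)%VF.

Definition cov Q : 'End(X) :=
  vexp Q (fun x : X => tensor x x)
  - tensor (vexp Q (fun x : X => x)) (vexp Q (fun x : X => x)).

Definition Top Q : 'End(X) :=
  (invsqrt (fdiag (cov Q)) \o goff (cov Q) \o invsqrt (fdiag (cov Q)))%VF.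

(* The laws at which Top is meaningful. *)
Definition admissible Q : Prop :=
  (\int[Q]_x (enorm (x : X) ^+ 2)%:E < +oo)%E /\ lker (fdiag (cov Q)) = 0%VS.

Definition R_fun (j : nat) Q : R := (eigenvalues (Top Q))`_j.

(* The scale of b is fixed by <b(Q), D b(Q)> = 1 with D = fdiag (cov Q). This is
   norm 1 at a law where D is the identity, but it is not norm 1 nearby: along a
   contamination at x of a centred such law, it gives the derivative of b the
   component -(\sum_k <b_k, x_k>^2 - 1)/2 on b, where norm 1 would give 0. *)
Definition eigenvector_functional (j : nat) (b : probability X R -> X) : Prop :=
  forall Q, admissible Q ->
    Top Q (b Q) = R_fun j Q *: b Q /\ ip (b Q) (fdiag (cov Q) (b Q)) = 1.

Definition A_fun (b : probability X R -> X) Q : X :=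
  invsqrt (fdiag (cov Q)) (b Q).

End MultipleSetCanonicalAnalysis.

Section RandomVector.
Context {R : realType} {K : nat} {E : 'I_K -> euclidType R}.
Context d {Omega : measurableType d} (P : probability Omega R).
Variable X : {mfun Omega >-> eprod E}.

Definition law : probability (eprod E) R := distribution P X.

Definition Vblock (k l : 'I_K) : 'Hom(E l, E k) :=
  vexp P (fun w => tensor (ecomp (X w) l) (ecomp (X w) k)).

End RandomVector.

(* Main.v *)
Require Import Defs.
From HB Require Import structures.
From mathcomp Require Import all_boot all_order all_algebra.
From mathcomp Require Import perm complex ring lra.
From mathcomp Require Import all_classical all_reals all_analysis.
From mathcomp Require Import measurable_realfun.

(** The contaminated law at [x] with weight [e] has covariance
    [(1 - e) (V + e x (x) x)], whose block diagonal [(1 - e) (I + e D)] is, on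
    each block, a multiple of a rank-one perturbation of the identity.  Its
    inverse square root [S e] is therefore explicit, and [Top] at the
    contaminated law is [S e o (1 - e) (G + e H) o S e], with derivative
    [T' = H - (D G + G D) / 2] at [e = 0].

    By the Courant-Fischer inequality the [j]-th eigenvalue is continuous in
    [e].  Pairing [T_e b_e = r_e b_e] with the eigenvectors [beta m] of [T_0]
    gives [(r_e - rho m) <b_e, beta m> = <(T_e - T_0) b_e, beta m>].  For
    [m <> j] this forces [b_e] towards [beta j] and yields its derivative along
    [beta m]; for [m = j] it yields the derivative of [r_e].  The component of
    [b_e] on [beta j] is governed by the normalisation [<b_e, D_e b_e> = 1],
    where [D_e] is the block diagonal of the covariance. *)

(** Limits of vectors and operators are tested on inner products, so every limit is a limit of
    reals. In finite dimension this is convergence in norm, and it is compatible with application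
    and composition. The eigenvectors are not constructed as functions of [e]: they come from the
    given [B], of which only the eigenvalue equation, the normalisation and the sign are known along
    the contamination. Boundedness and convergence of [b e] must therefore be extracted from these
    before any difference quotient is taken. Since [invsqrt] and [eigenvalues] are choices among the
    objects with a given property, uniqueness of the positive inverse square root and of the ordered
    spectrum is what gives access to their values. *)

Set Implicit Arguments.
Unset Strict Implicit.
Unset Printing Implicit Defensive.

Import Order.TTheory GRing.Theory Num.Theory.
Import numFieldNormedType.Exports.

Local Open Scope classical_set_scope.
Local Open Scope ring_scope.

(** * Inner products and orthonormal bases *)

Section InnerProduct.
Context {R : realType} {V : euclidType R}.
Implicit Types u v w : V.

Lemma ipDl u v w : ip (u + v) w = ip u w + ip v w.
Proof. exact: linearDl. Qed.
Lemma ipDr u v w : ip u (v + w) = ip u v + ip u w.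
Proof. exact: linearDr. Qed.
Lemma ipBl u v w : ip (u - v) w = ip u w - ip v w.
Proof. exact: linearBl. Qed.
Lemma ipBr u v w : ip u (v - w) = ip u v - ip u w.
Proof. exact: linearBr. Qed.
Lemma ipZl a u v : ip (a *: u) v = a * ip u v.
Proof. exact: linearZl_LR. Qed.
Lemma ipZr a u v : ip u (a *: v) = a * ip u v.
Proof. exact: linearZr_LR. Qed.
Lemma ip0l u : ip 0 u = 0. Proof. exact: linear0l. Qed.
Lemma ip0r u : ip u 0 = 0. Proof. exact: linear0r. Qed.
Lemma ipC u v : ip u v = ip v u.
Proof. by rewrite hermC expr0 mul1r. Qed.

Lemma ip_suml I r (Q : pred I) (F : I -> V) u :
  ip (\sum_(i <- r | Q i) F i) u = \sum_(i <- r | Q i) ip (F i) u.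
Proof. exact: linear_sumlz. Qed.
Lemma ip_sumr I r (Q : pred I) (F : I -> V) u :
  ip u (\sum_(i <- r | Q i) F i) = \sum_(i <- r | Q i) ip u (F i).
Proof. exact: linear_sumr. Qed.

Lemma ip_gt0 u : u != 0 -> 0 < ip u u.
Proof. exact: neq0_dnorm_gt0. Qed.

Lemma ip_ge0 u : 0 <= ip u u.
Proof. by have [->|/ip_gt0/ltW//] := eqVneq u 0; rewrite ip0l. Qed.

Lemma ip_eq0 u : ip u u = 0 -> u = 0.
Proof. by move=> u0; apply/eqP; apply: contra_eqT u0 => /ip_gt0/gt_eqF->. Qed.

Lemma ip_ext u v : (forall w, ip u w = ip v w) -> u = v.
Proof.
move=> uv; apply/eqP; rewrite -subr_eq0; apply/eqP/ip_eq0.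
by rewrite ipBl uv subrr.
Qed.

Lemma enorm_sqr u : enorm u ^+ 2 = ip u u.
Proof. by rewrite /enorm sqr_sqrtr ?ip_ge0. Qed.

Lemma ip_CauchySchwarz u v : ip u v ^+ 2 <= ip u u * ip v v.
Proof.
have [->|v0] := eqVneq v 0; first by rewrite !ip0r mulr0 expr0n.
have vv := ip_gt0 v0.
(* This is [|v|^2] times the component of [u] orthogonal to [v], which avoids a division. *)
have := ip_ge0 (ip v v *: u - ip u v *: v).
rewrite ipBl !ipBr !ipZl !ipZr (ipC v u) => h.
rewrite -(ler_pM2l vv) -subr_ge0; apply: le_trans h _.
by rewrite le_eqVlt; apply/orP; left; apply/eqP; ring.
Qed.

End InnerProduct.

Lemma linfun_def (R : nzRingType) (U V : vectType R) (f : U -> V) :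
  linear f -> linfun f =1 f.
Proof.
move=> lf u.
pose F : {linear U -> V} := HB.pack f (GRing.isLinear.Build _ _ _ _ f lf).
exact: (lfunE F).
Qed.

Section Orthonormal.
Context {R : realType} {V : euclidType R}.
Implicit Types u v w : V.

Definition orthonormal_family n (b : 'I_n -> V) : Prop :=
  forall i m, ip (b i) (b m) = (i == m)%:R.

Lemma orthonormal_family_free n (b : 'I_n -> V) :
  orthonormal_family b -> free [tuple b i | i < n].
Proof.
move=> ob; apply/freeP => a a0 i.
have := congr1 (ip^~ (b i)) a0; rewrite ip0l ip_suml (bigD1 i) //= big1.
  by rewrite ipZl nth_mktuple ob eqxx mulr1 addr0.
by move=> m mi; rewrite ipZl nth_mktuple ob (negbTE mi) mulr0.
Qed.

Section Basis.
Variables (n : nat) (b : 'I_n -> V).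
Hypothesis (nV : n = \dim {:V}) (ob : orthonormal_family b).

Lemma orthonormal_expansion u : u = \sum_i ip u (b i) *: b i.
Proof.
have /coord_basis -/(_ u (memvf u)) eu : basis_of fullv [tuple b i | i < n].
  by rewrite basisEfree orthonormal_family_free // subvf size_tuple -nV /=.
rewrite {1}eu; apply: eq_bigr => i _; rewrite nth_mktuple; congr (_ *: _).
rewrite [in RHS]eu ip_suml (bigD1 i) //= big1.
  by rewrite ipZl nth_mktuple ob eqxx mulr1 addr0.
by move=> m mi; rewrite ipZl nth_mktuple ob (negbTE mi) mulr0.
Qed.

Lemma ip_parseval u v : ip u v = \sum_i ip u (b i) * ip v (b i).
Proof.
rewrite {1}(orthonormal_expansion v) ip_sumr.
by apply: eq_bigr => i _; rewrite ipZr mulrC.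
Qed.

(** This separates the dependence on [A] from that on [u] and [v]: convergence or smallness of
    finitely many entries of [A] then controls the whole form. *)
Lemma ip_form (A : 'End(V)) u v :
  ip (A u) v = \sum_i \sum_m ip u (b i) * ip v (b m) * ip (A (b i)) (b m).
Proof.
rewrite {1}(orthonormal_expansion u) linear_sum ip_suml; apply: eq_bigr => i _.
rewrite linearZ /= ipZl (ip_parseval (A _)) mulr_sumr; apply: eq_bigr => m _.
by ring.
Qed.

End Basis.
End Orthonormal.

(** * Spectral theorem for self-adjoint operators *)

Section RealEigenvector.
Context {R : rcfType}.

(* A complex eigenvector [u + i v] with eigenvalue [x + i y]. *)
Lemma real_matrix_eigenpair n (M : 'M[R]_n) : (0 < n)%N ->
  exists u v : 'rV[R]_n, exists x y : R,
    [/\ (u != 0) || (v != 0), u *m M = x *: u - y *: v &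
        v *m M = y *: u + x *: v].
Proof.
move=> n0; have [a /eigenvalueP[w wM w0]] :=
  eigenvalue_closed (map_mx (real_complex R) M) n0.
pose re (z : R[i]) := complex.Re z; pose im (z : R[i]) := complex.Im z.
have reD : {morph re : x y / x + y} by move=> [? ?] [? ?].
have imD : {morph im : x y / x + y} by move=> [? ?] [? ?].
exists (map_mx re w), (map_mx im w), (re a), (im a); split.
- apply: contraNT w0; rewrite negb_or !negbK => /andP[/eqP u0 /eqP v0].
  apply/eqP/rowP => i; move/rowP/(_ i): u0; move/rowP/(_ i): v0.
  by rewrite !mxE; case: (w 0 i) => ? ? /= -> ->.
- apply/rowP => i; move/rowP/(_ i): wM; rewrite !mxE => /(congr1 re).
  rewrite (big_morph re reD erefl) => e; rewrite -[RHS]/(re a * re (w 0 i) - im a * im (w 0 i)).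
  have -> : re a * re (w 0 i) - im a * im (w 0 i) = re (a * w 0 i).
    by case: (a) (w 0 i) => ? ? [? ?].
  rewrite -e; apply: eq_bigr => k _; rewrite !mxE.
  by case: (w 0 k) => ? ? /=; rewrite mulr0 subr0.
- apply/rowP => i; move/rowP/(_ i): wM; rewrite !mxE => /(congr1 im).
  rewrite (big_morph im imD erefl) => e.
  have -> : im a * re (w 0 i) + re a * im (w 0 i) = im (a * w 0 i).
    by case: (a) (w 0 i) => ? ? [? ?] /=; rewrite addrC.
  rewrite -e; apply: eq_bigr => k _; rewrite !mxE.
  by case: (w 0 k) => ? ? /=; rewrite mulr0 add0r.
Qed.

(** The matrix result is applied to the restriction of [A] to [W]: [F] maps coordinate rows to [W]
    and turns [A] into right multiplication by [M]. *)
Lemma invariant_eigenpair (V : vectType R) (A : 'End(V)) (W : {vspace V}) :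
  W != 0%VS -> (A @: W <= W)%VS ->
  exists u v, exists x y : R,
    [/\ u \in W, v \in W, (u != 0) || (v != 0), A u = x *: u - y *: v &
        A v = y *: u + x *: v].
Proof.
move=> W0 AW; pose n := \dim W; pose X := vbasis W.
have n0 : (0 < n)%N by rewrite lt0n dimv_eq0.
have bX : basis_of W X := vbasisP W.
pose M : 'M[R]_n := \matrix_(i, j) coord X j (A X`_i).
pose F (r : 'rV[R]_n) := \sum_i r 0 i *: X`_i.
have FW r : F r \in W.
  by apply: memv_suml => i _; rewrite memvZ // vbasis_mem // mem_nth ?size_tuple.
have FM r : A (F r) = F (r *m M).
  rewrite /F linear_sum.
  under eq_bigr => i _.
    rewrite linearZ /=.
    have AX : A X`_i \in W.
      by apply: (subvP AW); rewrite memv_img // vbasis_mem // mem_nth ?size_tuple.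
    rewrite [A _](coord_basis bX AX) scaler_sumr; over.
  rewrite exchange_big /=; apply: eq_bigr => i _; rewrite mxE scaler_suml.
  by apply: eq_bigr => k _; rewrite mxE scalerA.
have Finj r : F r = 0 -> r = 0.
  have /freeP fX := basis_free bX.
  by move=> /fX r0; apply/rowP => i; rewrite r0 mxE.
have FL x r y t : F (x *: r + y *: t) = x *: F r + y *: F t.
  rewrite /F !scaler_sumr -big_split; apply: eq_bigr => i _ /=.
  by rewrite !mxE scalerDl !scalerA.
have [u [v [x [y [uv uM vM]]]]] := real_matrix_eigenpair M n0.
exists (F u), (F v), x, y; split => //.
- by apply: contraTT uv; rewrite !negb_or !negbK => /andP[/eqP/Finj-> /eqP/Finj->]; rewrite eqxx.
- by rewrite FM uM -!scaleNr FL.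
- by rewrite FM vM FL.
Qed.

End RealEigenvector.

Section Spectral.
Context {R : realType} {V : euclidType R}.
Variables (A : 'End(V)) (saA : selfadjoint A).

(** For a complex eigenvector [u + i v], comparing [<A u, v>] with [<u, A v>] gives
    [y (|u|^2 + |v|^2) = 0]. The eigenvalue is thus real, and whichever of [u], [v] is nonzero is a
    real eigenvector. *)
Lemma selfadjoint_invariant_eigenvector (W : {vspace V}) :
  W != 0%VS -> (A @: W <= W)%VS ->
  exists u, exists x : R, [/\ u \in W, ip u u = 1 & A u = x *: u].
Proof.
move=> W0 AW; have [u [v [x [y [uW vW uv Au Av]]]]] := invariant_eigenpair W0 AW.
suff [w [wW w0 Aw]] : exists w, [/\ w \in W, w != 0 & A w = x *: w].
  exists ((Num.sqrt (ip w w))^-1 *: w), x; split; first by rewrite memvZ.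
    rewrite ipZl ipZr mulrA -expr2 exprVn sqr_sqrtr ?ip_ge0 //.
    by rewrite mulVf // gt_eqF // ip_gt0.
  by rewrite linearZ /= Aw !scalerA mulrC.
have y0 : y = 0.
  have h := saA u v.
  rewrite Au Av ipBl ipDr !ipZl !ipZr in h.
  have {}h : y * (ip u u + ip v v) = 0 by lra.
  apply/eqP; move/eqP: h; rewrite mulf_eq0 => /orP[//|h].
  move: uv; have := ip_ge0 u; have := ip_ge0 v => v0 u0.
  have u1 : u = 0 by apply: ip_eq0; move/eqP: h => h; lra.
  have v1 : v = 0 by apply: ip_eq0; move/eqP: h => h; lra.
  by rewrite u1 v1 eqxx.
case/orP: uv => w0; [exists u | exists v]; split => //.
  by rewrite Au y0 scale0r subr0.
by rewrite Av y0 scale0r add0r.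
Qed.

(** The orthogonal complement [W] of the first [n] eigenvectors is the kernel of a map into a space
    of dimension [n], hence nonzero, and self-adjointness makes it invariant; a unit eigenvector in
    [W] extends the family. *)
Lemma selfadjoint_orthonormal_eigenfamily n : (n <= \dim {:V})%N ->
  exists (g : 'I_n -> V) (s : 'I_n -> R),
    orthonormal_family g /\ forall i, A (g i) = s i *: g i.
Proof.
elim: n => [|n IHn] nV; first by exists (fun=> 0), (fun=> 0); split; case.
have [g [s [og gs]]] := IHn (ltnW nV).
pose f (v : V) : 'rV[R]_n := \row_i ip (g i) v.
have lf : linear f by move=> a u v; apply/rowP => i; rewrite !mxE ipDr ipZr.
pose W := lker (linfun f).
have WP v : reflect (forall i, ip (g i) v = 0) (v \in W).
  rewrite memv_ker (linfun_def lf); apply: (iffP eqP) => [fv i|fv].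
    by move/rowP/(_ i): fv; rewrite !mxE.
  by apply/rowP => i; rewrite !mxE.
have W0 : W != 0%VS.
  rewrite -dimv_eq0 -lt0n; have := limg_ker_dim (linfun f) {:V}.
  rewrite capfv => e; rewrite -(ltn_add2r (\dim (linfun f @: {:V}))) add0n e.
  apply: leq_trans nV; apply: leq_ltn_trans (dimvS (subvf _)) _.
  by rewrite dimvf /= /dim /= mul1n.
have AW : (A @: W <= W)%VS.
  apply/subvP => _ /memv_imgP[v /WP vW ->]; apply/WP => i.
  by rewrite -saA gs ipZl vW mulr0.
have [u [x [/WP uW uu Au]]] := selfadjoint_invariant_eigenvector W0 AW.
(* [unlift ord_max] is [None] only at the last index, which receives the new pair. *)
exists (fun i => oapp g u (unlift ord_max i)), (fun i => oapp s x (unlift ord_max i)).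
split; last by move=> i; case: unliftP => [i' _|_] /=.
move=> i m.
case: unliftP => [i' ->|->]; case: unliftP => [m' ->|->] //=.
- by rewrite og (inj_eq lift_inj).
- by rewrite uW eq_sym (negbTE (neq_lift _ _)).
- by rewrite ipC uW (negbTE (neq_lift _ _)).
- by rewrite uu eqxx.
Qed.

End Spectral.

(** * Eigenvalues *)

Section Eigenvalues.
Context {R : realType} {V : euclidType R}.
Implicit Types A B : 'End(V).

Record eigenbasis A n (g : 'I_n -> V) (s : 'I_n -> R) : Prop := Eigenbasis {
  eigenbasis_dim : n = \dim {:V};
  eigenbasis_orthonormal : orthonormal_family g;
  eigenbasis_eigen : forall i, A (g i) = s i *: g i;
  eigenbasis_noninc : forall i m : 'I_n, (i <= m)%N -> s m <= s i }.

Lemma selfadjoint_eigenbasis A : selfadjoint A ->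
  exists g s, @eigenbasis A (\dim {:V}) g s.
Proof.
move=> saA; have [g [s [og gs]]] := selfadjoint_orthonormal_eigenfamily saA (leqnn _).
pose t := [tuple s i | i < \dim {:V}].
have /tuple_permP[p tp] : perm_eq (sort >=%R t) t by rewrite perm_sort.
have s'E i : s (p i) = (sort >=%R t)`_i.
  by rewrite tp -tnth_nth tnth_mktuple tnth_mktuple.
exists (g \o p), (s \o p); split => //.
- by move=> i m /=; rewrite og (inj_eq perm_inj).
- by move=> i /=; rewrite gs.
- move=> i m im /=; rewrite !s'E.
  apply: (@sorted_leq_nth _ >=%R) => //.
  + by move=> x y z yx zy; exact: le_trans zy yx.
  + by move=> x; exact: lexx.
  + by apply: sort_sorted => x y; exact: (le_total y x).
  + by rewrite inE size_sort size_tuple.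
  + by rewrite inE size_sort size_tuple.
Qed.

Section EigenbasisTheory.
Variables (A : 'End(V)) (n : nat) (g : 'I_n -> V) (s : 'I_n -> R).
Hypothesis gA : eigenbasis A g s.
Let nV := eigenbasis_dim gA.
Let og := eigenbasis_orthonormal gA.

Lemma eigenbasis_ip u i : ip (A u) (g i) = s i * ip u (g i).
Proof.
rewrite {1}(orthonormal_expansion nV og u) linear_sum ip_suml (bigD1 i) //= big1.
  by rewrite linearZ /= (eigenbasis_eigen gA) !ipZl og eqxx mulr1 addr0 mulrC.
by move=> m mi; rewrite linearZ /= (eigenbasis_eigen gA) !ipZl og (negbTE mi) !mulr0.
Qed.

Lemma eigenbasis_form u : ip (A u) u = \sum_i s i * ip u (g i) ^+ 2.
Proof.
rewrite (ip_parseval nV og (A u)); apply: eq_bigr => i _.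
by rewrite eigenbasis_ip expr2 mulrA.
Qed.

Lemma eigenbasis_neq0 i : g i != 0.
Proof.
by apply/eqP => g0; have /eqP := og i i; rewrite g0 ip0l eqxx eq_sym oner_eq0.
Qed.

(** Pairing [A v = a v] with [g i] gives [s i = a] whenever [<v, g i>] is nonzero, so the eigenspace
    is spanned by the free family of those [g i] with [s i = a]. *)
Lemma eigenbasis_dim_leigenspace a :
  \dim (passmx.leigenspace A a) = count_mem a [tuple s i | i < n].
Proof.
pose X := [tuple g i | i < n]; pose p := [pred v | A v == a *: v].
have memE v : (v \in passmx.leigenspace A a) = (A v == a *: v).
  by rewrite memv_ker add_lfunE opp_lfunE scale_lfunE id_lfunE subr_eq0.
have -> : passmx.leigenspace A a = <<[seq v <- X | p v]>>%VS.
  apply/vspaceP => v; rewrite memE; apply/eqP/idP => [Av|].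
    rewrite (orthonormal_expansion nV og v); apply: memv_suml => i _.
    have [->|h] := eqVneq (ip v (g i)) 0; first by rewrite scale0r mem0v.
    apply/memvZ/memv_span; rewrite mem_filter /= (eigenbasis_eigen gA).
    have /eqP := eigenbasis_ip v i; rewrite Av ipZl (inj_eq (mulIf h)) => /eqP ->.
    by rewrite eqxx; apply/mapP; exists i => //; rewrite mem_enum.
  move=> vX; apply/eqP; rewrite -memE; apply: subvP vX; apply/span_subvP => w.
  by rewrite mem_filter memE /= => /andP[].
have fX : free [seq v <- X | p v] by rewrite filter_free // orthonormal_family_free.
rewrite (eqnP fX) size_filter !count_map.
apply: eq_count => i /=; rewrite (eigenbasis_eigen gA) -subr_eq0 -scalerBl.
by rewrite scaler_eq0 (negbTE (eigenbasis_neq0 i)) orbF subr_eq0.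
Qed.

Lemma eigenbasis_eigenvalue_seq : eigenvalue_seq A [tuple s i | i < n].
Proof.
split; last by move=> a; rewrite eigenbasis_dim_leigenspace.
apply/(sortedP 0) => i; rewrite size_tuple => ilt.
have e (k : nat) (h : (k < n)%N) : [tuple s i | i < n]`_k = s (Ordinal h).
  by rewrite -[k in LHS]/(nat_of_ord (Ordinal h)) nth_mktuple.
by rewrite (e _ ilt) (e _ (ltnW ilt)); apply: (eigenbasis_noninc gA) => /=.
Qed.

End EigenbasisTheory.

Lemma eigenvalue_seq_inj A s t :
  eigenvalue_seq A s -> eigenvalue_seq A t -> s = t.
Proof.
move=> [ss sA] [tt tA]; apply: (@sorted_eq _ >=%R) => //.
- by move=> x y z yx zy; exact: le_trans zy yx.
- by move=> x y /le_anti.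
- by apply/allP => x _ /=; rewrite sA tA.
Qed.

Lemma eigenvalues_nth A n (g : 'I_n -> V) s (i : 'I_n) :
  eigenbasis A g s -> (eigenvalues A)`_i = s i.
Proof.
move=> /eigenbasis_eigenvalue_seq As.
have -> : eigenvalues A = [tuple s i | i < n].
  apply: (eigenvalue_seq_inj _ As).
  by apply: (@xgetPex _ [::] [set s | eigenvalue_seq A s]); exists (tval [tuple s i | i < n]).
by rewrite nth_mktuple.
Qed.

(* Courant-Fischer: a nonzero vector spanned by the first [j + 1] vectors of
   [g] and orthogonal to the first [j] vectors of [h]. *)
Lemma eigenvalue_le A B n (g h : 'I_n -> V) s t (d : R) (j : 'I_n) :
  eigenbasis A g s -> eigenbasis B h t ->
  (forall u, ip (A u) u <= ip (B u) u + d * ip u u) -> s j <= t j + d.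
Proof.
move=> gA hB AB.
have nV := eigenbasis_dim gA; have og := eigenbasis_orthonormal gA.
have oh := eigenbasis_orthonormal hB.
pose wg (i : 'I_j.+1) : 'I_n := widen_ord (ltn_ord j) i.
pose wh (i : 'I_j) : 'I_n := widen_ord (ltnW (ltn_ord j)) i.
pose M : 'M[R]_(j.+1, j) := \matrix_(i, m) ip (g (wg i)) (h (wh m)).
(* [M] has one more row than columns, so its left kernel is nonzero. *)
have /rowV0Pn[r /sub_kermxP rM r0] : kermx M != 0.
  by rewrite -mxrank_eq0 mxrank_ker -lt0n subn_gt0 ltnS rank_leq_col.
pose u := \sum_i r 0 i *: g (wg i).
have ug_lo i : ip u (g (wg i)) = r 0 i.
  rewrite ip_suml (bigD1 i) //= ipZl og eqxx mulr1 big1 ?addr0 // => m mi.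
  rewrite ipZl og; case: eqP => [/(congr1 val) /= e|]; last by rewrite mulr0.
  by move: mi; rewrite -val_eqE /= e eqxx.
have ug_hi (i : 'I_n) : (j < i)%N -> ip u (g i) = 0.
  move=> ji; rewrite ip_suml big1 // => m _; rewrite ipZl og.
  case: eqP => [/(congr1 val) /= e|]; last by rewrite mulr0.
  by have := ltn_ord m; rewrite e ltnS leqNgt ji.
have uh_lo (i : 'I_n) : (i < j)%N -> ip u (h i) = 0.
  move=> ij; move/rowP/(_ (Ordinal ij)): rM; rewrite !mxE ip_suml => rM.
  rewrite -[RHS]rM; apply: eq_bigr => m _; rewrite mxE ipZl; congr (_ * ip _ (h _)).
  exact: val_inj.
have u0 : u != 0.
  apply: contra_neq r0 => u0; apply/rowP => i.
  by rewrite -ug_lo u0 ip0l mxE.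
have uu := ip_gt0 u0.
have uuE k (k' : 'I_k -> V) (C : 'End(V)) c : eigenbasis C k' c ->
    ip u u = \sum_i ip u (k' i) ^+ 2.
  by move=> kC; rewrite (ip_parseval (eigenbasis_dim kC) (eigenbasis_orthonormal kC)).
have lo : s j * ip u u <= ip (A u) u.
  rewrite (eigenbasis_form gA) (uuE _ _ _ _ gA) mulr_sumr; apply: ler_sum => i _.
  have [ji|ij] := ltnP j i; first by rewrite ug_hi // expr0n !mulr0.
  by rewrite ler_wpM2r ?sqr_ge0 // (eigenbasis_noninc gA).
have hi : ip (B u) u <= t j * ip u u.
  rewrite (eigenbasis_form hB) (uuE _ _ _ _ hB) mulr_sumr; apply: ler_sum => i _.
  have [ij|ji] := ltnP i j; first by rewrite uh_lo // expr0n !mulr0.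
  by rewrite ler_wpM2r ?sqr_ge0 // (eigenbasis_noninc hB).
rewrite -(ler_pM2r uu) mulrDl; apply: le_trans lo _; apply: le_trans (AB u) _.
by rewrite lerD2r.
Qed.

End Eigenvalues.

(** Any operator chosen by [invsqrt] has the same square as [S], because [A] is injective. On an
    eigenvector of the difference, equal squares give the eigenvalue times a sum of two quadratic
    forms equal to zero; strict positivity of [S] makes that sum positive. *)
Lemma invsqrt_unique {R : realType} {V : euclidType R} (A S : 'End(V)) :
  selfadjoint S -> (forall u, u != 0 -> 0 < ip (S u) u) ->
  (S \o S \o A)%VF = \1%VF -> invsqrt A = S.
Proof.
move=> saS S0 SSA; have Sge u : 0 <= ip (S u) u.
  by have [->|/S0/ltW//] := eqVneq u 0; rewrite ip0r.
have := @xgetPex _ 0 [set S : 'End(V) | nonneg_op S /\ (S \o S \o A)%VF = \1%VF].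
case; first by exists S.
rewrite -/(invsqrt A); set S' := invsqrt A => -[saS' S'0] S'S'A.
have kA : lker A == 0%VS.
  rewrite -subv0; apply/subvP => v; rewrite memv_ker memv0 => /eqP Av.
  by have /lfunP/(_ v) := SSA; rewrite !comp_lfunE Av !linear0 id_lfunE => <-.
have SS : (S' \o S')%VF = (S \o S)%VF.
  by rewrite -[LHS](lker0_compfK kA) S'S'A -[RHS](lker0_compfK kA) SSA.
have saC : selfadjoint (S' - S).
  by move=> u v; rewrite !add_lfunE !opp_lfunE ipBl ipBr saS' saS.
have [g [c gC]] := selfadjoint_eigenbasis saC.
have Cg i : (S' - S)%VF (g i) = 0.
  rewrite (eigenbasis_eigen gC).
  suff -> : c i = 0 by rewrite scale0r.
  have pos : 0 < ip (S' (g i)) (g i) + ip (S (g i)) (g i).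
    by rewrite ltr_wpDl ?S0 ?(eigenbasis_neq0 gC).
  (* [S' C + C S = S' S' - S S = 0] for [C = S' - S] *)
  have e : c i * (ip (S' (g i)) (g i) + ip (S (g i)) (g i)) = 0.
    rewrite mulrDr -ipZl -linearZ /= -ipZr -(eigenbasis_eigen gC) -saC.
    rewrite !add_lfunE !opp_lfunE linearB /= ipBl.
    have /lfunP/(_ (g i)) := SS; rewrite !comp_lfunE => ->.
    by rewrite ipBl; ring.
  by apply/eqP; move/eqP: e; rewrite mulf_eq0 (gt_eqF pos) orbF.
apply/lfunP => u; apply/eqP; rewrite -subr_eq0 -opp_lfunE -add_lfunE.
rewrite (orthonormal_expansion (eigenbasis_dim gC) (eigenbasis_orthonormal gC) u).
by rewrite linear_sum big1 // => i _; rewrite linearZ /= Cg scaler0.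
Qed.

(** * Perturbation of eigenvalues and eigenvectors *)

Lemma cvgr_sum {R : realType} (I T : Type) (F : set_system T) {FF : Filter F}
    (r : seq I) (Q : pred I) (f : I -> T -> R) (l : I -> R) :
  (forall i, Q i -> f i e @[e --> F] --> l i) ->
  \sum_(i <- r | Q i) f i e @[e --> F] --> \sum_(i <- r | Q i) l i.
Proof. by move=> fl; apply: cvg_big => //; exact: add_continuous. Qed.

Lemma near_cvg_to {R : realType} (T : Type) (F : set_system T) {FF : Filter F}
    (f g : T -> R) (l m : R) : f e @[e --> F] --> l -> l = m ->
  (\forall e \near F, f e = g e) -> g e @[e --> F] --> m.
Proof.
move=> fl <- fg; apply: cvg_trans fl; apply: near_eq_cvg.
by apply: filterS fg => e ->.
Qed.

Lemma cvgr_dist_bound {R : realType} (T : Type) (F : set_system T) {FF : Filter F}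
    (d g : T -> R) (l c : R) : d e @[e --> F] --> (0 : R) ->
  (\forall e \near F, `|g e - l| <= d e * c) -> g e @[e --> F] --> l.
Proof.
move=> d0 gl; apply/cvgrPdistC_lt => eps eps0.
have dc : d e * c @[e --> F] --> (0 : R).
  by apply: near_cvg_to (cvgM d0 (cvg_cst c)) _ _; [rewrite mul0r | near=> e].
near=> e; apply: (@le_lt_trans _ _ (d e * c)); near: e => //.
exact: cvgr_lt dc _ eps0.
Unshelve. all: by end_near. Qed.

(** * Weak convergence of vectors and operators *)

Section WeakConvergence.
Context {R : realType} {T : Type} (F : set_system T) {FF : Filter F}.
Context {V : euclidType R}.
Implicit Types (a : T -> R) (u v : T -> V) (l m : V).
Implicit Types (A B : T -> 'End(V)) (L M : 'End(V)).

Definition vcvg u l : Prop := forall w, ip (u e) w @[e --> F] --> ip l w.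
Definition ocvg A L : Prop := forall w, vcvg (fun e => A e w) (L w).

Lemma near_vcvg u v l : (\forall e \near F, u e = v e) -> vcvg u l -> vcvg v l.
Proof.
move=> uv ul w; apply: cvg_trans (ul w); apply: near_eq_cvg.
by apply: filterS uv => e ->.
Qed.

Lemma vcvg_cst l : vcvg (fun=> l) l.
Proof. by move=> w; exact: cvg_cst. Qed.

Lemma vcvgD u v l m : vcvg u l -> vcvg v m -> vcvg (fun e => u e + v e) (l + m).
Proof.
move=> ul vm w; rewrite ipDl; under eq_cvg do rewrite ipDl.
exact: cvgD (ul w) (vm w).
Qed.

Lemma vcvgZ a u (c : R) l :
  a e @[e --> F] --> c -> vcvg u l -> vcvg (fun e => a e *: u e) (c *: l).
Proof.
move=> ac ul w; rewrite ipZl; under eq_cvg do rewrite ipZl.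
exact: cvgM ac (ul w).
Qed.

Lemma ocvgD A B L M : ocvg A L -> ocvg B M -> ocvg (fun e => A e + B e) (L + M).
Proof.
move=> AL BM w; rewrite add_lfunE.
have := vcvgD (AL w) (BM w); apply: near_vcvg.
by near=> e; rewrite add_lfunE.
Unshelve. all: by end_near. Qed.

Lemma ocvgZ a A (c : R) L :
  a e @[e --> F] --> c -> ocvg A L -> ocvg (fun e => a e *: A e) (c *: L).
Proof.
move=> ac AL w; rewrite scale_lfunE.
have := vcvgZ ac (AL w); apply: near_vcvg.
by near=> e; rewrite scale_lfunE.
Unshelve. all: by end_near. Qed.

Lemma ocvg_cst L : ocvg (fun=> L) L.
Proof. by move=> w; exact: vcvg_cst. Qed.

Lemma near_ocvg A B L : (\forall e \near F, A e = B e) -> ocvg A L -> ocvg B L.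
Proof.
move=> AB AL w; apply: near_vcvg (AL w).
by apply: filterS AB => e ->.
Qed.

Lemma near_ocvg_to A B L M : ocvg A L -> L = M ->
  (\forall e \near F, A e = B e) -> ocvg B M.
Proof. by move=> AL <- /near_ocvg; exact. Qed.

Lemma exists_orthonormal_basis :
  exists b : 'I_(\dim {:V}) -> V, orthonormal_family b.
Proof.
(* An eigenbasis of the zero operator is just an orthonormal basis. *)
have sa0 : selfadjoint (0 : 'End(V)) by move=> u v; rewrite !zero_lfunE ip0l ip0r.
by have [g [s /eigenbasis_orthonormal og]] := selfadjoint_eigenbasis sa0; exists g.
Qed.

Lemma vcvg_basis n (b : 'I_n -> V) u l : n = \dim {:V} -> orthonormal_family b ->
  (forall i, ip (u e) (b i) @[e --> F] --> ip l (b i)) -> vcvg u l.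
Proof.
move=> nV ob ul w; rewrite (ip_parseval nV ob).
under eq_cvg do rewrite (ip_parseval nV ob).
by apply: cvgr_sum => i _; apply: cvgM; [exact: ul | exact: cvg_cst].
Qed.

Lemma vcvg_ip u v l m : vcvg u l -> vcvg v m ->
  ip (u e) (v e) @[e --> F] --> ip l m.
Proof.
have [b ob] := exists_orthonormal_basis; move=> ul vm.
rewrite (ip_parseval erefl ob); under eq_cvg do rewrite (ip_parseval erefl ob).
by apply: cvgr_sum => i _; apply: cvgM; [exact: ul | exact: vm].
Qed.

Lemma ocvg_app A u L l : ocvg A L -> vcvg u l -> vcvg (fun e => A e (u e)) (L l).
Proof.
have [b ob] := exists_orthonormal_basis; move=> AL ul w.
rewrite (ip_form erefl ob); under eq_cvg do rewrite (ip_form erefl ob).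
apply: cvgr_sum => i _; apply: cvgr_sum => m _; apply: cvgM; last exact: AL.
by apply: cvgM; [exact: ul | exact: cvg_cst].
Qed.

Lemma ocvg_comp A B L M :
  ocvg A L -> ocvg B M -> ocvg (fun e => (A e \o B e)%VF) (L \o M)%VF.
Proof.
move=> AL BM w; rewrite comp_lfunE; apply: near_vcvg (ocvg_app AL (BM w)).
by near=> e; rewrite comp_lfunE.
Unshelve. all: by end_near. Qed.

Lemma vcvg_enorm u l : vcvg u l <-> enorm (u e - l) @[e --> F] --> (0 : R).
Proof.
split=> [ul|ul w].
  suff: Num.sqrt (ip (u e - l) (u e - l)) @[e --> F] --> Num.sqrt (ip (0 : V) 0).
    by rewrite ip0l sqrtr0.
  have h : ip (u e - l) (u e - l) @[e --> F] --> ip (0 : V) 0.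
    by apply: vcvg_ip; rewrite -(subrr l); apply: vcvgD => //; exact: vcvg_cst.
  exact: continuous_cvg (@sqrt_continuous R _) h.
have h : enorm (u e - l) * enorm w @[e --> F] --> (0 : R).
  by rewrite -(mul0r (enorm w)); apply: cvgM => //; exact: cvg_cst.
apply/cvgrPdist_lt => eps eps0.
apply: filterS (cvgr_lt _ h _ eps0) => e; apply: le_lt_trans.
rewrite distrC -ipBl -[leRHS]ger0_norm ?mulr_ge0 ?sqrtr_ge0 //.
by rewrite -ler_sqr ?nnegrE // !real_normK ?num_real // exprMn !enorm_sqr ip_CauchySchwarz.
Qed.

(* Weak convergence is uniform because the dimension is finite. *)
Lemma ocvg_bound A L : ocvg A L ->
  exists2 d : T -> R, d e @[e --> F] --> (0 : R) &
    forall e, 0 <= d e /\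
      forall u v : V, `|ip ((A e - L)%VF u) v| <= d e * (enorm u * enorm v).
Proof.
have [b ob] := exists_orthonormal_basis; move=> AL.
(* The bound sums the absolute entries of [A e - L] in an orthonormal basis; coordinates of [u] and
   [v] are at most their norms. *)
exists (fun e => \sum_i \sum_m `|ip ((A e - L)%VF (b i)) (b m)|).
  rewrite [X in _ --> X](_ : _ = \sum_(i < \dim {:V}) \sum_(m < \dim {:V}) 0); last first.
    by rewrite big1 // => i _; rewrite big1.
  apply: cvgr_sum => i _; apply: cvgr_sum => m _.
  rewrite -(@normr0 R R); apply: cvg_norm; rewrite -(ip0l (b m)) -(subrr (L (b i))).
  under eq_cvg do rewrite add_lfunE opp_lfunE.
  by apply: vcvgD; [exact: AL | exact: vcvg_cst].
have bw w i : `|ip w (b i)| <= enorm w.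
  rewrite -ler_sqr ?nnegrE ?sqrtr_ge0 // real_normK ?num_real // enorm_sqr.
  by rewrite (le_trans (ip_CauchySchwarz _ _)) // ob eqxx mulr1.
split=> [|u v]; first by apply: sumr_ge0 => i _; apply: sumr_ge0.
rewrite (ip_form erefl ob) mulr_suml.
apply: le_trans (ler_norm_sum _ _ _) _; apply: ler_sum => i _.
rewrite mulr_suml; apply: le_trans (ler_norm_sum _ _ _) _; apply: ler_sum => m _.
by rewrite !normrM mulrC ler_wpM2l // ler_pM.
Qed.

End WeakConvergence.

(** * One-sided perturbation of an eigenpair *)

Section Perturbation.
Context {R : realType} {V : euclidType R}.
Local Notation n := (\dim {:V}).
Local Notation right0 := ((0 : R)^'+).

Lemma cvg_scaled_id (u : R -> V) (w l : V) :
  vcvg right0 (fun e => e^-1 *: (u e - w)) l -> vcvg right0 u w.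
Proof.
move=> ul.
have e0 : (e : R) @[e --> right0] --> (0 : R) by exact: cvg_at_right_filter cvg_id.
have h : vcvg right0 (fun e => e *: (e^-1 *: (u e - w)) + w) (0 *: l + w).
  by apply: vcvgD; [exact: vcvgZ | exact: vcvg_cst].
move: h; rewrite scale0r add0r => h.
apply: near_vcvg h; near=> e.
have e_neq0 : e != 0 by rewrite gt_eqF.
by rewrite scalerA divff // scale1r subrK.
Unshelve. all: by end_near. Qed.

Lemma ocvg_scaled (T : R -> 'End(V)) (T0 T' : 'End(V)) :
  ocvg right0 (fun e => e^-1 *: (T e - T0)) T' -> ocvg right0 T T0.
Proof.
move=> TT' w; apply: (@cvg_scaled_id _ _ (T' w)); apply: near_vcvg (TT' w).
by near=> e; rewrite scale_lfunE add_lfunE opp_lfunE.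
Unshelve. all: by end_near. Qed.

Variables (T D : R -> 'End(V)) (T0 T' D' : 'End(V)).
Variables (beta : 'I_n -> V) (rho : 'I_n -> R) (j : 'I_n).
Variables (r : R -> R) (b : R -> V).
Hypothesis T0_beta : eigenbasis T0 beta rho.
Hypothesis dT : ocvg right0 (fun e => e^-1 *: (T e - T0)) T'.
Hypothesis dD : ocvg right0 (fun e => e^-1 *: (D e - \1%VF)) D'.
Hypothesis T_b : \forall e \near right0, T e (b e) = r e *: b e.
Hypothesis D_b : \forall e \near right0, ip (b e) (D e (b e)) = 1.

Let ob := eigenbasis_orthonormal T0_beta.
Let T_cvg : ocvg right0 T T0 := ocvg_scaled dT.
Let D_cvg : ocvg right0 D \1%VF := ocvg_scaled dD.

(** Since [|<(T e - T0) u, u>| <= d e |u|^2], applying [eigenvalue_le] in both directions gives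
    [|r e - rho j| <= d e], whatever the multiplicities. *)
Lemma eigenvalue_cvg :
  (\forall e \near right0, selfadjoint (T e) /\ r e = (eigenvalues (T e))`_j) ->
  r e @[e --> right0] --> rho j.
Proof.
move=> rE; have [d d0 dP] := ocvg_bound T_cvg.
have dist e : selfadjoint (T e) /\ r e = (eigenvalues (T e))`_j ->
    rho j - d e <= r e <= rho j + d e.
  move=> [/selfadjoint_eigenbasis[g [s gT]] ->]; rewrite (eigenvalues_nth j gT).
  have bnd u : `|ip (T e u) u - ip (T0 u) u| <= d e * ip u u.
    rewrite -ipBl -opp_lfunE -add_lfunE -enorm_sqr expr2.
    by case: (dP e).
  apply/andP; split.
    rewrite lerBlDr; apply: eigenvalue_le T0_beta gT _ => u.
    by have := bnd u; rewrite ler_norml => /andP[h _]; lra.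
  apply: eigenvalue_le gT T0_beta _ => u.
  by have := bnd u; rewrite ler_norml => /andP[_ h]; lra.
apply: (@squeeze_cvgr _ _ _ _ (fun e => rho j - d e) (fun e => rho j + d e)).
- by near=> e; apply: dist; near: e.
- by rewrite -[X in _ --> X]subr0; apply: cvgB => //; exact: cvg_cst.
- by rewrite -[X in _ --> X]addr0; apply: cvgD => //; exact: cvg_cst.
Unshelve. all: by end_near. Qed.

(** Convergence of [b e] serves twice: it gives the limit of the pairing with the difference
    quotient of [T], and it sends [<b e, beta j>] to 1, so that this factor can be divided out. *)
Lemma eigenvalue_derivative : vcvg right0 b (beta j) ->
  e^-1 * (r e - rho j) @[e --> right0] --> ip (T' (beta j)) (beta j).
Proof.
move=> bj.
have bjj : ip (b e) (beta j) @[e --> right0] --> (1 : R).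
  by have := bj (beta j); rewrite ob eqxx.
have num : ip ((e^-1 *: (T e - T0)) (b e)) (beta j) @[e --> right0] -->
    ip (T' (beta j)) (beta j) by exact: ocvg_app.
apply: near_cvg_to (cvgM num (cvgV (oner_neq0 R) bjj)) _ _; first by rewrite invr1 mulr1.
near=> e.
have nz : ip (b e) (beta j) != 0 by near: e; apply: cvgr_neq0 bjj (oner_neq0 R).
have Tb : T e (b e) = r e *: b e by near: e.
rewrite /= scale_lfunE add_lfunE opp_lfunE ipZl ipBl Tb ipZl (eigenbasis_ip T0_beta).
by rewrite -mulrBl mulrA mulfK.
Unshelve. all: by end_near. Qed.

Section Simple.
Hypothesis rho_simple : forall m, m != j -> rho m != rho j.
Hypothesis r_cvg : r e @[e --> right0] --> rho j.

Let gap_neq0 m (mj : m != j) : rho j - rho m != 0.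
Proof. by rewrite subr_eq0 eq_sym rho_simple. Qed.

Let gap_cvg m : r e - rho m @[e --> right0] --> rho j - rho m.
Proof. by apply: cvgB => //; exact: cvg_cst. Qed.

(** The normalisation bounds [b e] and, as [D e] tends to the identity, sends [|b e|^2] to 1. The
    spectral gap kills the coordinates off [beta j], so [<b e, beta j>^2] tends to 1, and the sign
    condition selects the root 1. *)
Lemma eigenvector_cvg : (\forall e \near right0, 0 <= ip (b e) (beta j)) ->
  vcvg right0 b (beta j).
Proof.
move=> b_sign.
have [dT' dT'0 TP] := ocvg_bound T_cvg; have [dD' dD'0 DP] := ocvg_bound D_cvg.
have bDb : \forall e \near right0, `|ip (b e) (b e) - 1| <= dD' e * ip (b e) (b e).
  near=> e; have <- : ip (b e) (D e (b e)) = 1 by near: e.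
  rewrite distrC (ipC _ (D e _)) -[X in _ - ip X _]id_lfunE -ipBl -opp_lfunE -add_lfunE.
  by rewrite -enorm_sqr expr2; case: (DP e).
(* Once [dD' e < 1/2], the previous bound reads [|b e|^2 - 1 <= |b e|^2 / 2]. *)
have bb2 : \forall e \near right0, ip (b e) (b e) <= 2.
  near=> e.
  have h1 : `|ip (b e) (b e) - 1| <= dD' e * ip (b e) (b e) by near: e.
  have h2 : dD' e < 2^-1 by near: e; apply: cvgr_lt dD'0 _ _; rewrite invr_gt0.
  have h3 := ip_ge0 (b e).
  have h4 : dD' e * ip (b e) (b e) <= 2^-1 * ip (b e) (b e) by rewrite ler_wpM2r // ltW.
  by move: h1; rewrite ler_norml => /andP[_ h1]; lra.
have bm m : m != j -> ip (b e) (beta m) @[e --> right0] --> (0 : R).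
  move=> mj.
  have num : (r e - rho m) * ip (b e) (beta m) @[e --> right0] --> (0 : R).
    apply: (cvgr_dist_bound (c := 2) dT'0); near=> e; rewrite subr0.
    have Tb : T e (b e) = r e *: b e by near: e.
    rewrite mulrBl -(eigenbasis_ip T0_beta) -ipZl -Tb -ipBl -opp_lfunE -add_lfunE.
    have [d0 {}TP] := TP e; apply: le_trans (TP _ _) _.
    have -> : enorm (beta m) = 1 by rewrite /enorm ob eqxx sqrtr1.
    have b2 : enorm (b e) <= 2.
      rewrite -ler_sqr ?nnegrE ?sqrtr_ge0 // enorm_sqr.
      by apply: (@le_trans _ _ 2); [near: e | lra].
    by rewrite mulr1 ler_wpM2l.
  apply: near_cvg_to (cvgM num (cvgV (gap_neq0 mj) (@gap_cvg m))) _ _; first by rewrite mul0r.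
  near=> e.
  have nz : r e - rho m != 0 by near: e; apply: cvgr_neq0 (@gap_cvg m) (gap_neq0 mj).
  by rewrite /= /unstable.inv_fun; field.
have bb1 : ip (b e) (b e) @[e --> right0] --> (1 : R).
  apply: (cvgr_dist_bound (c := 2) dD'0); near=> e.
  apply: (@le_trans _ _ (dD' e * ip (b e) (b e))); first by near: e.
  by have [d0 _] := DP e; rewrite ler_wpM2l //; near: e.
have bj2 : ip (b e) (beta j) ^+ 2 @[e --> right0] --> (1 : R).
  have s0 : \sum_(m | m != j) ip (b e) (beta m) ^+ 2 @[e --> right0] --> (0 : R).
    rewrite [X in _ --> X](_ : _ = \sum_(m < n | m != j) 0); last by rewrite big1.
    apply: cvgr_sum => m mj.
    by apply: near_cvg_to (cvgM (bm m mj) (bm m mj)) _ _; [rewrite mul0r | near=> e].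
  apply: near_cvg_to (cvgB bb1 s0) _ _; first by rewrite subr0.
  near=> e.
  rewrite /= (ip_parseval erefl ob) (bigD1 j) //= -expr2.
  by under [X in _ + X - _]eq_bigr do rewrite -expr2; rewrite addrK.
apply: (vcvg_basis erefl ob) => m; rewrite ob.
have [<-|mj] := eqVneq j m; last by apply: bm; rewrite eq_sym.
have h : Num.sqrt (ip (b e) (beta j) ^+ 2) @[e --> right0] --> Num.sqrt (1 : R).
  exact: continuous_cvg (@sqrt_continuous R _) bj2.
apply: near_cvg_to h _ _; first by rewrite sqrtr1.
near=> e.
by rewrite /= sqrtr_sqr ger0_norm //; near: e.
Unshelve. all: by end_near. Qed.

Lemma eigenvector_derivative : vcvg right0 b (beta j) ->
  vcvg right0 (fun e => e^-1 *: (b e - beta j))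
    (\sum_(m | m != j) ((rho j - rho m)^-1 * ip (T' (beta j)) (beta m)) *: beta m
     - (2^-1 * ip (D' (beta j)) (beta j)) *: beta j).
Proof.
move=> bj.
have coord_lim m : m != j ->
    e^-1 * ip (b e) (beta m) @[e --> right0] -->
      (rho j - rho m)^-1 * ip (T' (beta j)) (beta m).
  move=> mj.
  have num : ip ((e^-1 *: (T e - T0)) (b e)) (beta m) @[e --> right0] -->
      ip (T' (beta j)) (beta m) by exact: ocvg_app.
  apply: near_cvg_to (cvgM (cvgV (gap_neq0 mj) (@gap_cvg m)) num) _ _ => //.
  near=> e.
  have nz : r e - rho m != 0 by near: e; apply: cvgr_neq0 (@gap_cvg m) (gap_neq0 mj).
  have Tb : T e (b e) = r e *: b e by near: e.
  rewrite /= scale_lfunE add_lfunE opp_lfunE ipZl ipBl Tb ipZl (eigenbasis_ip T0_beta).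
  by rewrite /unstable.inv_fun -mulrBl mulrCA mulKf.
have bjm m : ip (b e) (beta m) @[e --> right0] --> ((j == m)%:R : R).
  by have := bj (beta m); rewrite ob.
(* By Parseval, [1 - <b e, beta j>^2] is [<(D e - 1) b e, b e>] plus the squares of the other
   coordinates. Those coordinates are [O(e)], so their squares vanish after division by [e]. *)
have num : e^-1 * (ip (b e) (beta j) ^+ 2 - 1) @[e --> right0] -->
    - ip (D' (beta j)) (beta j).
  have s0 : \sum_(m | m != j) (e^-1 * ip (b e) (beta m)) * ip (b e) (beta m)
      @[e --> right0] --> (0 : R).
    rewrite [X in _ --> X](_ : _ = \sum_(m < n | m != j)
        ((rho j - rho m)^-1 * ip (T' (beta j)) (beta m)) * (j == m)%:R).
      by apply: cvgr_sum => m mj; apply: cvgM; [exact: coord_lim | exact: bjm].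
    by rewrite big1 // => m mj; rewrite eq_sym (negbTE mj) mulr0.
  have d0 : ip ((e^-1 *: (D e - \1%VF)) (b e)) (b e) @[e --> right0] -->
      ip (D' (beta j)) (beta j) by apply: vcvg_ip; first exact: ocvg_app.
  apply: near_cvg_to (cvgB (cvgN d0) s0) _ _; first by rewrite subr0.
  near=> e.
  have bDb : ip (b e) (D e (b e)) = 1 by near: e.
  rewrite /= !fctE scale_lfunE add_lfunE opp_lfunE id_lfunE ipZl ipBl (ipC (D e _)) bDb.
  under eq_bigr do rewrite -mulrA -expr2.
  rewrite -mulr_sumr (ip_parseval erefl ob) (bigD1 j) //= -expr2.
  by under [in X in 1 - X]eq_bigr do rewrite -expr2; ring.
(* Factoring [c^2 - 1 = (c - 1) (c + 1)] with [c = <b e, beta j>] recovers the quotient of [c - 1];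
   the limit 2 of [c + 1] is the source of the factor [2^-1]. *)
have den : ip (b e) (beta j) + 1 @[e --> right0] --> (2 : R).
  have := cvgD (bjm j) (cvg_cst (1 : R)); rewrite eqxx; exact.
have n2 : (2 : R) != 0 by rewrite pnatr_eq0.
apply: (vcvg_basis erefl ob) => m.
have -> : ip (\sum_(m | m != j) ((rho j - rho m)^-1 * ip (T' (beta j)) (beta m)) *: beta m
     - (2^-1 * ip (D' (beta j)) (beta j)) *: beta j) (beta m)
  = if m == j then - ip (D' (beta j)) (beta j) * 2^-1
    else (rho j - rho m)^-1 * ip (T' (beta j)) (beta m).
  rewrite ipBl ip_suml ipZl ob; case: (eqVneq m j) => [->|mj].
    rewrite big1; last by move=> i ij; rewrite ipZl ob (negbTE ij) mulr0.
    by rewrite sub0r mulr1 mulNr mulrC.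
  rewrite (bigD1 m) //= ipZl ob eqxx big1; last first.
    by move=> i /andP[_ im]; rewrite ipZl ob (negbTE im) mulr0.
  by rewrite mulr0 subr0 addr0 mulr1.
case: (eqVneq m j) => [->|mj].
  apply: near_cvg_to (cvgM num (cvgV n2 den)) _ _ => //.
  near=> e.
  have nz : ip (b e) (beta j) + 1 != 0 by near: e; apply: cvgr_neq0 den n2.
  by rewrite /= ipZl ipBl ob eqxx /unstable.inv_fun subr_sqr_1 -!mulrA mulfV // mulr1.
apply: near_cvg_to (coord_lim m mj) _ _ => //.
near=> e.
by rewrite ipZl ipBl ob eq_sym (negbTE mj) subr0.
Unshelve. all: by end_near. Qed.

End Simple.
End Perturbation.

(** * Covariance of the contaminated law *)

Section Moments.
Context {R : realType} d {T : measurableType d}.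
Implicit Types P : probability T R.

Lemma Rintegral_sum P (I : Type) (s : seq I) (f : I -> T -> R) :
  (forall i, P.-integrable setT (EFin \o f i)) ->
  P.-integrable setT (EFin \o (fun w => \sum_(i <- s) f i w)) /\
  \int[P]_w (\sum_(i <- s) f i w) = \sum_(i <- s) \int[P]_w f i w.
Proof.
move=> fi; elim: s => [|i s [IHi IHe]].
  rewrite big_nil; split; last first.
    by under eq_Rintegral do rewrite big_nil; rewrite /Rintegral integral0.
  apply: (eq_integrable measurableT (cst 0%E)); last exact: integrable0.
  by move=> w _; rewrite /= big_nil.
split.
  pose S w := \sum_(k <- s) f k w.
  apply: (eq_integrable measurableT (fun w => (f i w)%:E + (S w)%:E)%E); last exact: (integrableD measurableT (fi i) IHi).
  by move=> w _; rewrite /= big_cons.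
rewrite big_cons -IHe -RintegralD //.
by apply: eq_Rintegral => w _; rewrite big_cons.
Qed.

Lemma Rintegral_lincomb P (I : Type) (s : seq I) (f : I -> T -> R) (c : I -> R) :
  (forall i, P.-integrable setT (EFin \o f i)) ->
  P.-integrable setT (EFin \o (fun w => \sum_(i <- s) f i w * c i)) /\
  \int[P]_w (\sum_(i <- s) f i w * c i) = \sum_(i <- s) (\int[P]_w f i w) * c i.
Proof.
move=> fi.
have fci i : P.-integrable setT (EFin \o (fun w => f i w * c i)).
  apply: (eq_integrable measurableT (fun w => ((c i)%:E * (EFin \o f i) w)%E)).
    by move=> w _; rewrite /= -EFinM mulrC.
  exact: integrableZl.
have [h1 h2] := Rintegral_sum s fci; split=> //; rewrite h2.
apply: eq_bigr => i _; rewrite mulrC -RintegralZl //.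
by apply: eq_Rintegral => w _; rewrite mulrC.
Qed.

Lemma vexp_scalar P (W : vectType R) (phi : T -> W) (l : W -> R) :
  scalar l ->
  (forall i, P.-integrable setT (EFin \o (fun w => coord (vbasis {:W}) i (phi w)))) ->
  l (vexp P phi) = \int[P]_w l (phi w).
Proof.
move=> ll ci; pose L : {linear W -> R^o} :=
  HB.pack (l : W -> R^o) (GRing.isLinear.Build _ _ _ _ (l : W -> R^o) ll).
have lE (a : 'I_(\dim {:W}) -> R) :
    l (\sum_i a i *: (vbasis {:W})`_i) = \sum_i a i * l (vbasis {:W})`_i.
  rewrite -[l]/(L : W -> R) linear_sum; apply: eq_bigr => i _.
  by rewrite linearZ.
rewrite /vexp lE; have [_ <-] := Rintegral_lincomb (index_enum _)
  (fun i : 'I_(\dim {:W}) => l (vbasis {:W})`_i) ci.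
apply: eq_Rintegral => w _.
by rewrite [in RHS](coord_vbasis (memvf (phi w))) lE.
Qed.

Section Euclidean.
Context {U V : euclidType R}.

Lemma vexp_ip P (phi : T -> V) (u : V) :
  (forall v, P.-integrable setT (EFin \o (fun w => ip (phi w) v))) ->
  ip (vexp P phi) u = \int[P]_w ip (phi w) u.
Proof.
move=> phii; apply: (vexp_scalar (l := fun y => ip y u)).
  by move=> a x y; rewrite ipDl ipZl.
move=> i; have [b ob] := @exists_orthonormal_basis R V.
(* [vbasis] need not be orthonormal; its coordinates are integrable as combinations of inner
   products with the orthonormal [b]. *)
have [h _] := Rintegral_lincomb (index_enum _)
  (fun m : 'I_(\dim {:V}) => coord (vbasis {:V}) i (b m)) (fun m => phii (b m)).
apply: (eq_integrable measurableT _ _ _ h) => w _ /=; congr EFin.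
rewrite [in RHS](orthonormal_expansion erefl ob (phi w)) linear_sum.
by apply: eq_bigr => m _; rewrite linearZ.
Qed.

Lemma tensorE (x : U) (y : V) h : tensor x y h = ip x h *: y.
Proof.
by rewrite linfun_def // => a u v; rewrite ipDr ipZr scalerDl scalerA.
Qed.

Lemma vexp_tensor P (phi : T -> U) (psi : T -> V) (u : U) (v : V) :
  (forall u v, P.-integrable setT (EFin \o (fun w => ip (phi w) u * ip (psi w) v))) ->
  ip (vexp P (fun w => tensor (phi w) (psi w)) u) v =
  \int[P]_w (ip (phi w) u * ip (psi w) v).
Proof.
move=> phii; rewrite (vexp_scalar (l := fun A : 'Hom(U, V) => ip (A u) v)).
- by apply: eq_Rintegral => w _; rewrite tensorE ipZl.
- by move=> a A B; rewrite add_lfunE scale_lfunE ipDl ipZl.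
move=> i; have [b ob] := @exists_orthonormal_basis R U.
have [c oc] := @exists_orthonormal_basis R V.
have [h _] := Rintegral_lincomb (index_enum _)
  (fun p : 'I_(\dim {:U}) * 'I_(\dim {:V}) => coord (vbasis {:'Hom(U, V)}) i (tensor (b p.1) (c p.2)))
  (fun p => phii (b p.1) (c p.2)).
apply: (eq_integrable measurableT _ _ _ h) => w _ /=; congr EFin.
(* Expanding on the tensors of orthonormal basis vectors makes every coefficient a product of two
   inner products, integrable by assumption. *)
have -> : tensor (phi w) (psi w) = \sum_p
    (ip (phi w) (b p.1) * ip (psi w) (c p.2)) *: tensor (b p.1) (c p.2).
  apply/lfunP => t; rewrite tensorE sum_lfunE (ip_parseval erefl ob).
  rewrite {1}(orthonormal_expansion erefl oc (psi w)) scaler_suml.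
  rewrite -(pair_big xpredT xpredT (fun k m =>
    ((ip (phi w) (b k) * ip (psi w) (c m)) *: tensor (b k) (c m)) t)) /=.
  apply: eq_bigr => k _; rewrite scaler_sumr; apply: eq_bigr => m _.
  by rewrite scale_lfunE tensorE !scalerA (ipC t); congr (_ *: _); ring.
rewrite linear_sum; apply: eq_bigr => p _.
by rewrite linearZ.
Qed.

End Euclidean.

(** Measurability is asked of each inner product, so the notion also applies to maps into a single
    block [E k], on which no sigma-algebra is fixed. *)
Definition square_integrable {V : euclidType R} P (phi : T -> V) : Prop :=
  (forall u, measurable_fun setT (fun w => ip (phi w) u)) /\
  (\int[P]_w (enorm (phi w) ^+ 2)%:E < +oo)%E.

Lemma measurable_enorm_sqr {V : euclidType R} (phi : T -> V) :
  (forall u, measurable_fun setT (fun w => ip (phi w) u)) ->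
  measurable_fun setT (fun w => enorm (phi w) ^+ 2).
Proof.
move=> mphi; have [b ob] := @exists_orthonormal_basis R V.
apply: (eq_measurable_fun (fun w => \sum_i ip (phi w) (b i) ^+ 2)).
  move=> w _; rewrite enorm_sqr (ip_parseval erefl ob).
  by apply: eq_bigr => i _; rewrite expr2.
by apply: measurable_sum => i; exact: measurable_funX.
Qed.

Lemma integrable_enorm_sqr {V : euclidType R} P (phi : T -> V) :
  square_integrable P phi ->
  P.-integrable setT (EFin \o (fun w => enorm (phi w) ^+ 2)).
Proof.
move=> [mphi phi2]; apply/integrableP; split.
  by apply/measurable_EFinP; exact: measurable_enorm_sqr.
by under eq_integral do rewrite /= ger0_norm ?sqr_ge0 //.
Qed.

Lemma integrable_le P (f g : T -> R) :
  measurable_fun setT f -> P.-integrable setT (EFin \o g) ->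
  (forall w, `|f w| <= g w) -> P.-integrable setT (EFin \o f).
Proof.
move=> mf gi fg; apply: le_integrable gi => //; first exact/measurable_EFinP.
by move=> w _ /=; rewrite lee_fin; apply: le_trans (ler_norm _).
Qed.

Lemma integrable_ip_mul {U V : euclidType R} P (phi : T -> U) (psi : T -> V) u v :
  square_integrable P phi -> square_integrable P psi ->
  P.-integrable setT (EFin \o (fun w => ip (phi w) u * ip (psi w) v)).
Proof.
move=> phi2 psi2.
(* Domination by Cauchy-Schwarz and [a b <= a^2 + b^2] for nonnegative reals. *)
pose g w := ip u u * enorm (phi w) ^+ 2 + ip v v * enorm (psi w) ^+ 2.
apply: (@integrable_le _ _ g).
- by apply: measurable_funM; [exact: phi2.1 | exact: psi2.1].
- have h := integrableD measurableT
    (integrableZl measurableT (ip u u) (integrable_enorm_sqr phi2))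
    (integrableZl measurableT (ip v v) (integrable_enorm_sqr psi2)).
  exact: (eq_integrable measurableT _ _ _ h).
move=> w; rewrite /g !enorm_sqr normrM.
have := ip_CauchySchwarz (phi w) u; have := ip_CauchySchwarz (psi w) v.
rewrite -(real_normK (num_real (ip (phi w) u))) -(real_normK (num_real (ip (psi w) v))).
move: `|_| `|_| (normr_ge0 (ip (phi w) u)) (normr_ge0 (ip (psi w) v)) => a b a0 b0.
rewrite (mulrC (ip (phi w) _)) (mulrC (ip (psi w) _)) => h1 h2.
have := sqr_ge0 (a - b); nra.
Qed.

Lemma integrable_ip {V : euclidType R} P (phi : T -> V) u :
  square_integrable P phi -> P.-integrable setT (EFin \o (fun w => ip (phi w) u)).
Proof.
move=> phi2; pose g w := 1 + ip u u * enorm (phi w) ^+ 2.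
apply: (@integrable_le _ _ g).
- exact: phi2.1.
- have h := integrableD measurableT (finite_measure_integrable_cst P 1 measurableT)
    (integrableZl measurableT (ip u u) (integrable_enorm_sqr phi2)).
  exact: (eq_integrable measurableT _ _ _ h).
move=> w; rewrite /g !enorm_sqr.
have := ip_CauchySchwarz (phi w) u.
rewrite -(real_normK (num_real (ip (phi w) u))) mulrC.
move: `|_| (normr_ge0 (ip (phi w) u)) => a a0 h; have := sqr_ge0 (a - 1); nra.
Qed.

End Moments.

(** * Integration against a contaminated law *)

Section ContaminationIntegral.
Context d {T : measurableType d} {R : realType}.
Variables (P : probability T R) (x : T) (e : R).
Hypothesis e01 : 0 <= e <= 1.

Lemma clip01_id : clip01 e = e.
Proof.
by have /andP[e0 e1] := e01; rewrite /clip01 (min_idPl e1) (max_idPr e0).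
Qed.

Lemma ge0_integral_contamination (f : T -> \bar R) :
  measurable_fun setT f -> (forall y, 0 <= f y)%E ->
  (\int[contamination P x e]_y f y = (1 - e)%:E * \int[P]_y f y + e%:E * f x)%E.
Proof.
move=> mf f0; rewrite /contamination ge0_integral_measure_add //.
rewrite !ge0_integral_mscale // integral_dirac // diracT mul1e /=.
by rewrite clip01_id.
Qed.

Lemma Rintegral_contamination (f : T -> R) :
  P.-integrable setT (EFin \o f) ->
  \int[contamination P x e]_y f y = (1 - e) * \int[P]_y f y + e * f x.
Proof.
move=> fi; have /integrableP[mf _] := fi.
rewrite /Rintegral integralE.
rewrite !ge0_integral_contamination; first last.
- by move=> y; exact: funepos_ge0.
- exact: measurable_funepos.
- by move=> y; exact: funeneg_ge0.
- exact: measurable_funeneg.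
rewrite [in RHS]integralE.
(* Both parts have finite integral, so the difference of extended reals is a difference of reals. *)
have /fineK := integrable_fin_num measurableT (integrable_funepos measurableT fi).
have /fineK := integrable_fin_num measurableT (integrable_funeneg measurableT fi).
move=> <- <-.
have -> : ((EFin \o f)^\+ x = (Num.max (f x) 0)%:E)%E by rewrite funeposE EFin_max.
have -> : ((EFin \o f)^\- x = (Num.max (- f x) 0)%:E)%E by rewrite funenegE EFin_max.
have fE : f x = Num.max (f x) 0 - Num.max (- f x) 0.
  by rewrite /Num.max; case: ltP => h1; case: ltP => h2; lra.
by rewrite [in RHS]fE /=; ring.
Qed.

End ContaminationIntegral.

(** * Block structure of the product space and of the covariance *)

Section ProductSpace.
Context {R : realType} {K : nat} {E : 'I_K -> euclidType R}.
Local Notation X := (eprod E).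
Implicit Types (A : 'End(X)) (Q : probability X R) (u v : X).

Lemma ip_eprod u v : ip u v = \sum_k ip (ecomp u k) (ecomp v k).
Proof. by []. Qed.

Lemma ecomp_sum I (r : seq I) (Q : pred I) (F : I -> X) k :
  ecomp (\sum_(i <- r | Q i) F i) k = \sum_(i <- r | Q i) ecomp (F i) k.
Proof. by rewrite -tauE linear_sum; apply: eq_bigr => i _; exact: tauE. Qed.

Lemma ecomp_tau_adj_eq k (t : E k) : ecomp (tau_adj k t) k = t.
Proof. by rewrite tau_adjE ecompE eqtype.dfwith_in. Qed.

Lemma ecomp_tau_adj_neq k l (t : E l) : k != l -> ecomp (tau_adj l t) k = 0.
Proof. by move=> kl; rewrite tau_adjE ecompE eqtype.dfwith_out // eq_sym. Qed.

Lemma ecomp_sum_tau_adj (f : forall k, E k) k :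
  ecomp (\sum_l tau_adj l (f l)) k = f k.
Proof.
rewrite ecomp_sum (bigD1 k) //= ecomp_tau_adj_eq big1 ?addr0 // => l lk.
by rewrite ecomp_tau_adj_neq // eq_sym.
Qed.

Lemma ecomp_fdiag A u k :
  ecomp (fdiag A u) k = ecomp (A (tau_adj k (ecomp u k))) k.
Proof.
have -> : fdiag A u = \sum_l tau_adj l (ecomp (A (tau_adj l (ecomp u l))) l).
  by rewrite sum_lfunE; apply: eq_bigr => l _; rewrite !comp_lfunE !tauE.
exact: (ecomp_sum_tau_adj (fun k => ecomp (A (tau_adj k (ecomp u k))) k)).
Qed.

Lemma ecomp_goff A u k :
  ecomp (goff A u) k = \sum_(l | l != k) ecomp (A (tau_adj l (ecomp u l))) k.
Proof.
pose f k := \sum_(l | l != k) ecomp (A (tau_adj l (ecomp u l))) k.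
have -> : goff A u = \sum_l tau_adj l (f l).
  rewrite sum_lfunE; apply: eq_bigr => m _; rewrite sum_lfunE linear_sum.
  by apply: eq_bigr => l _; rewrite !comp_lfunE !tauE.
exact: ecomp_sum_tau_adj.
Qed.

Lemma ip_goff A u v : ip (goff A u) v =
  \sum_k \sum_(l | l != k) ip (A (tau_adj l (ecomp u l))) (tau_adj k (ecomp v k)).
Proof.
rewrite ip_eprod; apply: eq_bigr => k _; rewrite ecomp_goff ip_suml.
by apply: eq_bigr => l _; rewrite -tauE tau_adjP.
Qed.

Lemma fdiagD A B : fdiag (A + B) = fdiag A + fdiag B.
Proof.
apply/lfunP => u; apply: eprodP => k.
by rewrite add_lfunE ecompD !ecomp_fdiag add_lfunE ecompD.
Qed.

Lemma fdiagZ a A : fdiag (a *: A) = a *: fdiag A.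
Proof.
apply/lfunP => u; apply: eprodP => k.
by rewrite scale_lfunE ecompZ !ecomp_fdiag scale_lfunE ecompZ.
Qed.

Lemma goffD A B : goff (A + B) = goff A + goff B.
Proof.
apply/lfunP => u; apply: eprodP => k.
rewrite add_lfunE ecompD !ecomp_goff -big_split.
by apply: eq_bigr => l _; rewrite add_lfunE ecompD.
Qed.

Lemma goffZ a A : goff (a *: A) = a *: goff A.
Proof.
apply/lfunP => u; apply: eprodP => k.
rewrite scale_lfunE ecompZ !ecomp_goff scaler_sumr.
by apply: eq_bigr => l _; rewrite scale_lfunE ecompZ.
Qed.

Lemma goff_selfadjoint A : selfadjoint A -> selfadjoint (goff A).
Proof.
move=> saA u v; rewrite [RHS]ipC !ip_goff.
under eq_bigr => k _ do rewrite big_mkcond.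
under [RHS]eq_bigr => k _ do rewrite big_mkcond.
rewrite exchange_big; apply: eq_bigr => k _; apply: eq_bigr => l _ /=.
by rewrite eq_sym saA ipC.
Qed.

Lemma measurable_ip u : measurable_fun setT (fun y : X => ip y u).
Proof.
apply: (measurability _ (RGenOInfty.measurableE R)).
have u1 : 0 < 1 + enorm u by rewrite ltr_pwDl // sqrtr_ge0.
move=> _ [_ [r ->] <-]; rewrite setTI; apply: sub_sigma_algebra => y.
rewrite /preimage /= in_itv /= andbT => ry.
(* By Cauchy-Schwarz the inner product with [u] changes by at most [enorm u] times the distance; the
   added 1 keeps the divisor positive when [u = 0]. *)
exists ((ip y u - r) / (1 + enorm u)); first by rewrite divr_gt0 ?subr_gt0.
move=> z; rewrite ltr_pdivlMr // => zy; rewrite in_itv /= andbT.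
have := ip_CauchySchwarz (z - y) u; rewrite -!enorm_sqr -exprMn -real_normK ?num_real //.
rewrite ler_sqr ?nnegrE ?mulr_ge0 ?sqrtr_ge0 // ipBl ler_norml => /andP[h _].
have z0 : 0 <= enorm (z - y) by exact: sqrtr_ge0.
rewrite mulrDr mulr1 in zy.
by have : r < ip z u by lra.
Qed.

End ProductSpace.

Section Covariance.
Context {R : realType} {K : nat} {E : 'I_K -> euclidType R}.
Local Notation X := (eprod E).
Implicit Types (Q : probability X R) (u v x : X).

Lemma ip_cov Q u v : square_integrable Q (fun y : X => y) ->
  ip (cov Q u) v =
  \int[Q]_y (ip y u * ip y v) - (\int[Q]_y ip y u) * (\int[Q]_y ip y v).
Proof.
move=> Q2; rewrite add_lfunE opp_lfunE ipBl tensorE ipZl; congr (_ - _ * _).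
- by rewrite vexp_tensor // => s t; exact: integrable_ip_mul.
- by rewrite vexp_ip // => s; exact: integrable_ip.
- by rewrite vexp_ip // => s; exact: integrable_ip.
Qed.

Lemma cov_selfadjoint Q : square_integrable Q (fun y : X => y) -> selfadjoint (cov Q).
Proof.
move=> Q2 u v; rewrite [RHS]ipC !ip_cov // [X in _ - X]mulrC; congr (_ - _).
by apply: eq_Rintegral => y _; rewrite mulrC.
Qed.

Lemma square_integrable_contamination Q x e : 0 <= e <= 1 ->
  square_integrable Q (fun y : X => y) ->
  square_integrable (contamination Q x e) (fun y : X => y).
Proof.
move=> e01 [mi Q2]; split=> //.
rewrite ge0_integral_contamination //; last first.
- by move=> y; rewrite lee_fin sqr_ge0.
- by apply/measurable_EFinP; exact: measurable_enorm_sqr.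
apply: lte_add_pinfty; last by rewrite -EFinM ltry.
by apply: lte_mul_pinfty => //; rewrite lee_fin subr_ge0; case/andP: e01.
Qed.

(** The contaminated mean is [e x]; subtracting its square [e^2] from the weight [e] of [x (x) x] in
    the second moment leaves [e (1 - e)], whence the common factor [1 - e]. *)
Lemma cov_contamination Q x e : 0 <= e <= 1 ->
  square_integrable Q (fun y : X => y) -> (forall u, \int[Q]_y ip (y : X) u = 0) ->
  cov (contamination Q x e) = (1 - e) *: (cov Q + e *: tensor x x).
Proof.
move=> e01 Q2 Q0; apply/lfunP => u; apply: ip_ext => v.
rewrite ip_cov; last exact: square_integrable_contamination.
rewrite !Rintegral_contamination //; first last.
- exact: integrable_ip_mul.
- exact: integrable_ip.
- exact: integrable_ip.
rewrite scale_lfunE add_lfunE scale_lfunE tensorE ipZl ipDl !ipZl ip_cov // !Q0.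
by rewrite (ipC x); ring.
Qed.

End Covariance.

Section Law.
Context {R : realType} {K : nat} {E : 'I_K -> euclidType R}.
Context d {Omega : measurableType d} (P : probability Omega R).
Variable X : {mfun Omega >-> eprod E}.
Hypothesis X_mean0 : forall k, vexp P (fun w => ecomp (X w) k) = 0.
Hypothesis X_L2 : forall k, (\int[P]_w (enorm (ecomp (X w) k) ^+ 2)%:E < +oo)%E.

Lemma measurable_ip_comp u : measurable_fun setT (fun w => ip (X w) u).
Proof.
exact: (measurableT_comp (measurable_ip u) (measurable_funPT X)).
Qed.

Lemma square_integrable_ecomp k : square_integrable P (fun w => ecomp (X w) k).
Proof.
split=> // t; apply: eq_measurable_fun (measurable_ip_comp (tau_adj k t)).
by move=> w _; rewrite -tau_adjP tauE.
Qed.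

Lemma square_integrable_mfun : square_integrable P X.
Proof.
split; first exact: measurable_ip_comp.
have e w : (enorm (X w) ^+ 2)%:E = (\sum_k (enorm (ecomp (X w) k) ^+ 2)%:E)%E.
  by rewrite enorm_sqr ip_eprod sumEFin; congr EFin; apply: eq_bigr => k _; rewrite enorm_sqr.
under eq_integral do rewrite e.
rewrite ge0_integral_sum //; first exact: lte_sum_pinfty.
- move=> k; apply/measurable_EFinP; apply: measurable_enorm_sqr.
  by case: (square_integrable_ecomp k).
- by move=> k w _; rewrite lee_fin sqr_ge0.
Qed.

Lemma square_integrable_law : square_integrable (law P X) (fun y : eprod E => y).
Proof.
split; first exact: measurable_ip.
rewrite /law ge0_integral_distribution; first by case: square_integrable_mfun.
- by apply/measurable_EFinP; apply: measurable_enorm_sqr; exact: measurable_ip.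
- by move=> y; rewrite lee_fin sqr_ge0.
Qed.

Lemma Rintegral_law (f : eprod E -> R) :
  measurable_fun setT f -> P.-integrable setT (EFin \o (fun w => f (X w))) ->
  \int[law P X]_y f y = \int[P]_w f (X w).
Proof.
move=> mf fi; rewrite /Rintegral /law integral_distribution //.
exact/measurable_EFinP.
Qed.

Lemma law_mean0 u : \int[law P X]_y ip (y : eprod E) u = 0.
Proof.
rewrite Rintegral_law; [|exact: measurable_ip|]; last first.
  exact: integrable_ip square_integrable_mfun.
have [_] := Rintegral_sum (P := P) (index_enum 'I_K)
  (fun k => integrable_ip (ecomp u k) (square_integrable_ecomp k)).
rewrite -[LHS]/(\int[P]_w (\sum_k ip (ecomp (X w) k) (ecomp u k))) => ->.
rewrite big1 // => k _; rewrite -vexp_ip ?X_mean0 ?ip0l // => t.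
exact: integrable_ip (square_integrable_ecomp k).
Qed.

Lemma ip_cov_law k l (t : E l) (s : E k) :
  ip (cov (law P X) (tau_adj l t)) (tau_adj k s) = ip (Vblock P X k l t) s.
Proof.
rewrite ip_cov; last exact: square_integrable_law.
rewrite !law_mean0 mulr0 subr0 /Vblock vexp_tensor; last first.
  by move=> a b; apply: integrable_ip_mul; exact: square_integrable_ecomp.
rewrite Rintegral_law.
- by apply: eq_Rintegral => w _; rewrite -!tau_adjP !tauE.
- by apply: measurable_funM; exact: measurable_ip.
- by apply: integrable_ip_mul; exact: square_integrable_mfun.
Qed.

Lemma ecomp_cov_law k l (t : E l) :
  ecomp (cov (law P X) (tau_adj l t)) k = Vblock P X k l t.
Proof. by apply: ip_ext => s; rewrite -ip_cov_law -tau_adjP tauE. Qed.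

(** The blocks are those of the self-adjoint covariance. This relates the [V_lk x_k] of the
    eigenvalue formula to the [V_kl beta_l] of the eigenvector formula. *)
Lemma Vblock_adj k l (t : E l) (s : E k) :
  ip (Vblock P X k l t) s = ip t (Vblock P X l k s).
Proof.
rewrite -ip_cov_law (cov_selfadjoint square_integrable_law) ipC.
by rewrite ip_cov_law ipC.
Qed.

Lemma fdiag_cov_law : (forall k, Vblock P X k k = \1%VF) ->
  fdiag (cov (law P X)) = \1%VF.
Proof.
move=> X_cov1; apply/lfunP => u; apply: eprodP => k.
by rewrite ecomp_fdiag ecomp_cov_law X_cov1 !id_lfunE.
Qed.

End Law.

(** * Explicit inverse square root of the contaminated block diagonal *)

Section BlockOperator.
Context {R : realType} {K : nat} {E : 'I_K -> euclidType R}.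
Variable x : eprod E.
Implicit Types (c : 'I_K -> R) (u v : eprod E).

(** Free coefficients let one form cover both the block diagonal of [x (x) x] (all equal to 1) and
    the rank-one corrections in its inverse square root. *)
Definition blockop c : 'End(eprod E) :=
  \sum_k c k *: (tau_adj k \o tensor (ecomp x k) (ecomp x k) \o tau k)%VF.

Lemma ecomp_blockop c u k :
  ecomp (blockop c u) k = (c k * ip (ecomp x k) (ecomp u k)) *: ecomp x k.
Proof.
pose f k := (c k * ip (ecomp x k) (ecomp u k)) *: ecomp x k.
have -> : blockop c u = \sum_l tau_adj l (f l).
  rewrite sum_lfunE; apply: eq_bigr => l _.
  by rewrite scale_lfunE !comp_lfunE tauE tensorE -linearZ /= scalerA.
exact: ecomp_sum_tau_adj.
Qed.

Lemma ip_blockop c u v : ip (blockop c u) v =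
  \sum_k c k * (ip (ecomp x k) (ecomp u k) * ip (ecomp x k) (ecomp v k)).
Proof.
rewrite ip_eprod; apply: eq_bigr => k _.
by rewrite ecomp_blockop ipZl mulrA.
Qed.

Lemma blockop_selfadjoint c : selfadjoint (blockop c).
Proof.
move=> u v; rewrite [RHS]ipC !ip_blockop; apply: eq_bigr => k _.
by rewrite [_ * ip _ (ecomp v k)]mulrC.
Qed.

Lemma fdiag_tensor : fdiag (tensor x x) = blockop (fun=> 1).
Proof.
apply/lfunP => u; apply: eprodP => k.
by rewrite ecomp_fdiag ecomp_blockop mul1r tensorE ecompZ -tau_adjP tauE.
Qed.

Lemma ip_goff_tensor u v : ip (goff (tensor x x) u) v =
  \sum_k \sum_(l | l != k)
    ip (ecomp x l) (ecomp u l) * ip (ecomp x k) (ecomp v k).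
Proof.
rewrite ip_goff; apply: eq_bigr => k _; apply: eq_bigr => l _.
by rewrite tensorE ipZl -!tau_adjP !tauE.
Qed.

Lemma tensor_selfadjoint : selfadjoint (tensor x x).
Proof. by move=> u v; rewrite !tensorE ipZl ipZr mulrC (ipC u). Qed.

(* [(1 + e x_k (x) x_k)^(-1/2) = 1 + c x_k (x) x_k], where [c] would be
   [((1 + e s)^(-1/2) - 1) / s] with [s = |x_k|^2], written so that [s = 0] is
   not a special case. *)
Definition rank1_coef (e s : R) : R :=
  - (e / (Num.sqrt (1 + e * s) * (1 + Num.sqrt (1 + e * s)))).

Definition root_coef e (k : 'I_K) : R := rank1_coef e (ip (ecomp x k) (ecomp x k)).

Definition contaminated_root (e : R) : 'End(eprod E) :=
  (Num.sqrt (1 - e))^-1 *: (\1%VF + blockop (root_coef e)).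

(** With [c] the coefficient, [1 + c s = 1 / sqrt (1 + e s)], which is positive. The last identity
    is [(1 + c s)^2 (1 + e s) = 1] with a factor [s] cancelled, so that it also determines [c] at
    [s = 0]. *)
Lemma rank1_coefP e s : 0 <= e -> 0 <= s ->
  [/\ rank1_coef e s <= 0, 0 < 1 + rank1_coef e s * s &
      e + rank1_coef e s * (1 + e * s) * (2 + rank1_coef e s * s) = 0].
Proof.
move=> e0 s0; rewrite /rank1_coef; set q := Num.sqrt (1 + e * s).
have es : 0 <= e * s by rewrite mulr_ge0.
have q0 : 0 < q by rewrite sqrtr_gt0; lra.
have q2 : q ^+ 2 = 1 + e * s by rewrite sqr_sqrtr //; lra.
have cs : - (e / (q * (1 + q))) * s = q^-1 - 1.
  have -> : - (e / (q * (1 + q))) * s = - (e * s / (q * (1 + q))) by ring.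
  have -> : e * s = q ^+ 2 - 1 by rewrite q2; ring.
  by field; rewrite !gt_eqF //; lra.
split.
- by rewrite oppr_le0 divr_ge0 // mulr_ge0 //; lra.
- by rewrite cs addrC subrK invr_gt0.
- by rewrite cs -q2; field; rewrite !gt_eqF //; lra.
Qed.

Section Root.
Variable e : R.
Hypothesis e01 : 0 <= e < 1.

Let e0 : 0 <= e. Proof. by case/andP: e01. Qed.
Let e1 : 0 < 1 - e. Proof. by rewrite subr_gt0; case/andP: e01. Qed.

Lemma contaminated_root_selfadjoint : selfadjoint (contaminated_root e).
Proof.
move=> u v; rewrite !scale_lfunE !add_lfunE !id_lfunE ipZl ipZr ipDl ipDr.
by rewrite blockop_selfadjoint.
Qed.

Lemma contaminated_root_gt0 u : u != 0 -> 0 < ip (contaminated_root e u) u.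
Proof.
move=> u0; rewrite scale_lfunE add_lfunE id_lfunE ipZl ipDl ip_blockop ip_eprod.
rewrite pmulr_rgt0 ?invr_gt0 ?sqrtr_gt0 // -big_split /=.
(* The coefficient is nonpositive, so Cauchy-Schwarz bounds the block form below by
   [(1 + c s) |u_k|^2]. *)
have term k : (1 + root_coef e k * ip (ecomp x k) (ecomp x k)) *
    ip (ecomp u k) (ecomp u k) <= ip (ecomp u k) (ecomp u k) +
    root_coef e k * (ip (ecomp x k) (ecomp u k) * ip (ecomp x k) (ecomp u k)).
  have [c0 _ _] := rank1_coefP e0 (ip_ge0 (ecomp x k)).
  rewrite mulrDl mul1r lerD2l -mulrA ler_wnM2l // -expr2; exact: ip_CauchySchwarz.
have pos k : 0 < 1 + root_coef e k * ip (ecomp x k) (ecomp x k).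
  by have [] := rank1_coefP e0 (ip_ge0 (ecomp x k)).
have [k uk] : exists k, ecomp u k != 0.
  apply/existsP; apply: contraNT u0; rewrite negb_exists => /forallP h.
  by apply/eqP/eprodP => k; rewrite ecompE; apply/eqP; have := h k; rewrite negbK.
rewrite (bigD1 k) //= ltr_pwDl //.
  by apply: lt_le_trans (term k); rewrite mulr_gt0 ?ip_gt0.
apply: sumr_ge0 => l _; apply: le_trans (term l).
by rewrite mulr_ge0 ?ip_ge0 // ltW.
Qed.

Lemma contaminated_rootK : (contaminated_root e \o contaminated_root e \o
  ((1 - e) *: (\1%VF + e *: blockop (fun=> 1%R))))%VF = \1%VF.
Proof.
have a2 : (Num.sqrt (1 - e))^-1 * (Num.sqrt (1 - e))^-1 * (1 - e) = 1.
  by rewrite -invfM -expr2 sqr_sqrtr ?ltW // mulVf // gt_eqF.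
apply/lfunP => u; apply: eprodP => k; rewrite id_lfunE !comp_lfunE.
rewrite !(scale_lfunE, add_lfunE, id_lfunE, ecompZ, ecompD, ecomp_blockop, ipZr, ipDr).
have [_ _] := rank1_coefP e0 (ip_ge0 (ecomp x k)); rewrite -/(root_coef e k).
move: (root_coef e k) ((Num.sqrt (1 - e))^-1 : R) a2 => c a a2.
set s := ip (ecomp x k) (ecomp x k); set p := ip (ecomp x k) (ecomp u k) => ce.
rewrite !(scalerDr, scalerA) -!addrA -!scalerDl.
(* The total coefficient of [x_k] contains the expression that vanishes by [rank1_coefP]. *)
rewrite [X in _ + X *: _](_ : _ = a * a * (1 - e) * p *
  (e + c * (1 + e * s) * (2 + c * s))); last by ring.
by rewrite ce mulr0 scale0r addr0 a2 scale1r.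
Qed.

Lemma invsqrt_contaminated :
  invsqrt ((1 - e) *: (\1%VF + e *: blockop (fun=> 1))) = contaminated_root e.
Proof.
by apply: invsqrt_unique; [exact: contaminated_root_selfadjoint
  | exact: contaminated_root_gt0 | exact: contaminated_rootK].
Qed.

End Root.
End BlockOperator.

(** * Derivatives at contamination weight zero *)

Section RootDerivative.
Context {R : realType}.
Local Notation right0 := ((0 : R)^'+).

Lemma cvg_right0 : (e : R) @[e --> right0] --> (0 : R).
Proof. exact: cvg_at_right_filter cvg_id. Qed.

(** One limit serves both quotients below: the expression is minus that of [rank1_coef], and at
    [s = -1] it is [((1 - e)^(-1/2) - 1) / e]. *)
Lemma cvg_inv_sqrt (s : R) :
  (Num.sqrt (1 + e * s) * (1 + Num.sqrt (1 + e * s)))^-1 @[e --> right0] --> (2^-1 : R).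
Proof.
have h : 1 + e * s @[e --> right0] --> (1 : R).
  apply: near_cvg_to (cvgD (cvg_cst (1 : R)) (cvgM cvg_right0 (cvg_cst s))) _ _.
    by rewrite mul0r addr0.
  by near=> e.
have q : Num.sqrt (1 + e * s) @[e --> right0] --> (1 : R).
  by rewrite -[X in _ --> X]sqrtr1; exact: continuous_cvg (@sqrt_continuous R _) h.
have n2 : 1 * (1 + 1) != 0 :> R by rewrite mul1r gt_eqF //; lra.
apply: near_cvg_to (cvgV n2 (cvgM q (cvgD (cvg_cst (1 : R)) q))) _ _.
  by rewrite mul1r.
by near=> e.
Unshelve. all: by end_near. Qed.

Lemma rank1_coef_derivative s :
  e^-1 * rank1_coef e s @[e --> right0] --> (- 2^-1 : R).
Proof.
apply: near_cvg_to (cvgN (cvg_inv_sqrt s)) _ _ => //.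
near=> e; have e0 : e != 0 by rewrite gt_eqF.
by rewrite /rank1_coef mulrN mulKf.
Unshelve. all: by end_near. Qed.

Lemma inv_sqrt_derivative :
  e^-1 * ((Num.sqrt (1 - e))^-1 - 1) @[e --> right0] --> (2^-1 : R).
Proof.
apply: near_cvg_to (cvg_inv_sqrt (-1)) _ _ => //.
near=> e; rewrite mulrN1; set q := Num.sqrt _.
have e0 : e != 0 by rewrite gt_eqF.
have e1 : 0 < 1 - e by rewrite subr_gt0; near: e; exact: nbhs_right_lt.
have q0 : 0 < q by rewrite sqrtr_gt0.
have q2 : q ^+ 2 = 1 - e by rewrite sqr_sqrtr // ltW.
have eq2 : e = 1 - q ^+ 2 by rewrite q2; ring.
apply: (mulfI e0); rewrite mulVKf // {1}eq2.
by field; rewrite !gt_eqF //; lra.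
Unshelve. all: by end_near. Qed.

End RootDerivative.

Lemma ocvg_sum {R : realType} {T : Type} (F : set_system T) {FF : Filter F}
    {V : euclidType R} (I : Type) (r : seq I) (A : I -> T -> 'End(V))
    (L : I -> 'End(V)) :
  (forall i, ocvg F (A i) (L i)) ->
  ocvg F (fun e => \sum_(i <- r) A i e) (\sum_(i <- r) L i).
Proof.
move=> AL; elim: r => [|i r IHr].
  by rewrite big_nil; apply: near_ocvg (@ocvg_cst _ _ F _ _ 0); near=> e; rewrite big_nil.
rewrite big_cons; apply: near_ocvg (ocvgD (AL i) IHr).
by near=> e; rewrite big_cons.
Unshelve. all: by end_near. Qed.

Section Derivatives.
Context {R : realType} {K : nat} {E : 'I_K -> euclidType R}.
Local Notation right0 := ((0 : R)^'+).
Variable x : eprod E.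
Implicit Types (u v : eprod E) (G H : 'End(eprod E)).

Let Dx : 'End(eprod E) := blockop x (fun=> 1).

Lemma contaminated_root_derivative :
  ocvg right0 (fun e => e^-1 *: (contaminated_root x e - \1%VF))
    (2^-1 *: (\1%VF - Dx)).
Proof.
have dB : ocvg right0 (fun e => e^-1 *: blockop x (root_coef x e)) (- 2^-1 *: Dx).
  rewrite /Dx /blockop scaler_sumr.
  apply: near_ocvg; last first.
    apply: (ocvg_sum (A := fun k e => (e^-1 * root_coef x e k) *:
      (tau_adj k \o tensor (ecomp x k) (ecomp x k) \o tau k)%VF)) => k.
    rewrite scale1r; apply: ocvgZ; last exact: ocvg_cst.
    exact: rank1_coef_derivative.
  by near=> e; rewrite scaler_sumr; apply: eq_bigr => k _; rewrite scalerA.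
have a1 : (Num.sqrt (1 - e))^-1 @[e --> right0] --> (1 : R).
  apply: near_cvg_to (cvgD (cvgM cvg_right0 inv_sqrt_derivative) (cvg_cst (1 : R))) _ _.
    by rewrite mul0r add0r.
  near=> e; have e0 : e != 0 by rewrite gt_eqF.
  by rewrite /= mulVKf // subrK.
(* With [a = (1 - e)^(-1/2)] and [B] the block correction, [a (1 + B) - 1 = (a - 1) 1 + a B]. *)
apply: near_ocvg_to (ocvgD (ocvgZ inv_sqrt_derivative
  (@ocvg_cst R R right0 _ _ (\1%VF : 'End(eprod E)))) (ocvgZ a1 dB)) _ _.
  by rewrite scale1r scaleNr -scalerBr.
near=> e.
rewrite /contaminated_root scalerBr [in RHS]scalerDr scalerDr !scalerA.
by rewrite mulrBr mulr1 scalerBl [_ / e]mulrC addrAC.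
Unshelve. all: by end_near. Qed.

(** The quotient is exactly [H - G - e H]. It is applied to the off-diagonal part of the covariance
    and, with [G] the identity, to its block diagonal. *)
Lemma scaled_affine_derivative G H :
  ocvg right0 (fun e => e^-1 *: ((1 - e) *: (G + e *: H) - G)) (H - G).
Proof.
apply: near_ocvg_to (ocvgD (@ocvg_cst R R right0 _ _ (H - G))
  (ocvgZ (cvgN (@cvg_right0 R)) (@ocvg_cst R R right0 _ _ H))) _ _.
  by rewrite oppr0 scale0r addr0.
near=> e.
have e0 : e != 0 by rewrite gt_eqF.
apply: (scalerI e0); rewrite !scalerA divff // scale1r !scalerDr.
rewrite !scalerA scalerN [RHS]addrAC -[X in _ = _ - X + _]scale1r -scalerBl.
rewrite addrAC -scalerDl addrC -scaleNr.
by congr (_ *: _ + _ *: _); ring.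
Unshelve. all: by end_near. Qed.

(** Telescoping: [S A S - G = (S - 1) A S + (A - G) S + G (S - 1)]. *)
Lemma sandwich_derivative (S : R -> 'End(eprod E)) (A : R -> 'End(eprod E)) G S' G' :
  ocvg right0 (fun e => e^-1 *: (S e - \1%VF)) S' ->
  ocvg right0 (fun e => e^-1 *: (A e - G)) G' ->
  ocvg right0 (fun e => e^-1 *: ((S e \o A e \o S e)%VF - G))
    ((S' \o G)%VF + G' + (G \o S')%VF).
Proof.
move=> dS dA; have S1 := ocvg_scaled dS; have A0 := ocvg_scaled dA.
apply: near_ocvg_to (ocvgD (ocvgD (ocvg_comp (ocvg_comp dS A0) S1) (ocvg_comp dA S1))
  (ocvg_comp (@ocvg_cst R R right0 _ _ G) dS)) _ _.
  by rewrite !comp_lfun1r.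
near=> e.
rewrite /= -!(comp_lfunZl, comp_lfunZr) -!scalerDr; congr (_ *: _).
rewrite !(comp_lfunDl, comp_lfunDr, comp_lfunNl, comp_lfunNr) comp_lfun1l comp_lfun1r.
by rewrite !addrA !subrK.
Unshelve. all: by end_near. Qed.

End Derivatives.

(** * The canonical operator along the contamination *)

Section ContaminatedLaw.
Context {R : realType} {K : nat} {E : 'I_K -> euclidType R}.
Context d {Omega : measurableType d} (P : probability Omega R).
Variable X : {mfun Omega >-> eprod E}.
Hypothesis X_mean0 : forall k, vexp P (fun w => ecomp (X w) k) = 0.
Hypothesis X_L2 : forall k, (\int[P]_w (enorm (ecomp (X w) k) ^+ 2)%:E < +oo)%E.
Hypothesis X_cov1 : forall k, Vblock P X k k = \1%VF.
Variable x : eprod E.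
Implicit Types (u v : eprod E).
Local Notation right0 := ((0 : R)^'+).
Local Notation Q := (contamination (law P X) x).
Local Notation G := (goff (cov (law P X))).
Local Notation H := (goff (tensor x x)).
Local Notation Dx := (blockop x (fun=> 1)).

Let law2 := square_integrable_law X_L2.

Lemma cov_contaminated e : 0 <= e <= 1 ->
  cov (Q e) = (1 - e) *: (cov (law P X) + e *: tensor x x).
Proof.
move=> e01; apply: cov_contamination => // u.
exact: law_mean0.
Qed.

Lemma fdiag_cov_contaminated e : 0 <= e <= 1 ->
  fdiag (cov (Q e)) = (1 - e) *: (\1%VF + e *: Dx).
Proof.
move=> e01; rewrite cov_contaminated // fdiagZ fdiagD fdiagZ fdiag_tensor.
by rewrite fdiag_cov_law.
Qed.

Lemma invsqrt_contaminated_law e : 0 <= e < 1 ->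
  invsqrt (fdiag (cov (Q e))) = contaminated_root x e.
Proof.
move=> e01; rewrite fdiag_cov_contaminated ?invsqrt_contaminated //.
by case/andP: e01 => -> /ltW ->.
Qed.

Lemma Top_contaminated e : 0 <= e < 1 ->
  Top (Q e) = (contaminated_root x e \o ((1 - e) *: (G + e *: H)) \o
    contaminated_root x e)%VF.
Proof.
move=> e01; rewrite /Top invsqrt_contaminated_law // cov_contaminated.
  by rewrite goffZ goffD goffZ.
by case/andP: e01 => -> /ltW ->.
Qed.

Lemma invsqrt_law : invsqrt (fdiag (cov (law P X))) = \1%VF.
Proof.
rewrite fdiag_cov_law //; apply: invsqrt_unique.
- by move=> u v; rewrite !id_lfunE.
- by move=> u u0; rewrite id_lfunE ip_gt0.
- by rewrite !comp_lfun1l.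
Qed.

Lemma Top_law : Top (law P X) = G.
Proof. by rewrite /Top invsqrt_law comp_lfun1l comp_lfun1r. Qed.

Lemma Top_contaminated_selfadjoint e : 0 <= e < 1 -> selfadjoint (Top (Q e)).
Proof.
move=> e01; rewrite Top_contaminated //.
move: (contaminated_root_selfadjoint x e); move: (contaminated_root x e) => S saS.
have saG := goff_selfadjoint (cov_selfadjoint law2).
have saH := goff_selfadjoint (tensor_selfadjoint x).
move=> u v; rewrite !comp_lfunE saS !scale_lfunE !add_lfunE !scale_lfunE.
by rewrite ipZl ipDl ipZl saG saH -ipZr -ipDr -ipZr saS.
Qed.

(** The functionals [B] are constrained only at admissible laws. The weight stays below 1 because at
    weight 1 the covariance vanishes. *)
Lemma admissible_contaminated e : 0 <= e < 1 -> admissible (Q e).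
Proof.
move=> e01; have e01' : 0 <= e <= 1 by case/andP: e01 => -> /ltW ->.
split; first by case: (square_integrable_contamination x e01' law2).
rewrite fdiag_cov_contaminated //; apply/eqP; rewrite -subv0; apply/subvP => v.
rewrite memv_ker memv0 => /eqP Av; have /lfunP/(_ v) := contaminated_rootK x e01.
by rewrite !comp_lfunE Av !linear0 id_lfunE => <-.
Qed.

Lemma admissible_law : admissible (law P X).
Proof.
split; first by case: law2.
rewrite fdiag_cov_law //; apply/eqP; rewrite -subv0; apply/subvP => v.
by rewrite memv_ker memv0 id_lfunE.
Qed.

Lemma near_right01 : \forall e \near right0, 0 <= e < 1.
Proof.
near=> e; apply/andP; split; first by rewrite ltW.
by near: e; exact: nbhs_right_lt.
Unshelve. all: by end_near. Qed.

(** Kept in the shape given by [sandwich_derivative]; the two halves of [G] coming from the roots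
    cancel the [- G] coming from the factor [1 - e]. *)
Definition Top_derivative : 'End(eprod E) :=
  ((2^-1 *: (\1 - Dx) \o G) + (H - G) + (G \o 2^-1 *: (\1 - Dx)))%VF.

Lemma Top_contaminated_derivative :
  ocvg right0 (fun e => e^-1 *: (Top (Q e) - G)) Top_derivative.
Proof.
have h := sandwich_derivative (@contaminated_root_derivative R K E x)
  (@scaled_affine_derivative R K E G H).
apply: near_ocvg h.
by apply: filterS near_right01 => e e01; rewrite Top_contaminated.
Qed.

Lemma fdiag_cov_contaminated_derivative :
  ocvg right0 (fun e => e^-1 *: (fdiag (cov (Q e)) - \1%VF)) (Dx - \1%VF).
Proof.
apply: near_ocvg (@scaled_affine_derivative R K E \1%VF Dx).
apply: filterS near_right01 => e /andP[e0 e1].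
by rewrite fdiag_cov_contaminated // e0 ltW.
Qed.

Lemma ip_goff_law u v : ip (G u) v =
  \sum_k \sum_(l | l != k) ip (Vblock P X k l (ecomp u l)) (ecomp v k).
Proof.
rewrite ip_goff; apply: eq_bigr => k _; apply: eq_bigr => l _.
exact: ip_cov_law.
Qed.

Lemma ip_Top_derivative u v : ip (Top_derivative u) v =
  \sum_k \sum_(l | l != k)
    (ip (ecomp v k) (ecomp x k) * ip (ecomp x l) (ecomp u l)
     - 2^-1 * (ip (ecomp v k) (ecomp x k) *
         ip (ecomp x k) (Vblock P X k l (ecomp u l)))
     - 2^-1 * (ip (ecomp x k) (Vblock P X k l (ecomp v l)) *
         ip (ecomp x k) (ecomp u k))).
Proof.
have saG : selfadjoint G := goff_selfadjoint (cov_selfadjoint law2).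
(* Self-adjointness of [G] and [Dx] moves one factor of each product onto [v], leaving only entries
   of [G] against explicit block vectors. *)
have -> : ip (Top_derivative u) v =
    ip (H u) v - 2^-1 * ip (G u) (Dx v) - 2^-1 * ip (G v) (Dx u).
  rewrite /Top_derivative !(add_lfunE, opp_lfunE, comp_lfunE, scale_lfunE, id_lfunE).
  have -> : G (2^-1 *: (u - Dx u)) = 2^-1 *: (G u - G (Dx u)).
    by rewrite linearZ linearB.
  rewrite !(ipBl, ipDl, ipZl) blockop_selfadjoint (saG (Dx u)).
  by rewrite (ipC (Dx u)); lra.
rewrite ip_goff_tensor !ip_goff_law !mulr_sumr -!sumrB; apply: eq_bigr => k _.
rewrite !mulr_sumr -!sumrB; apply: eq_bigr => l _.
rewrite !ecomp_blockop !ipZr !mul1r.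
rewrite (ipC (ecomp v k)) !(ipC (Vblock _ _ _ _ _)).
by ring.
Qed.

End ContaminatedLaw.

(** At a multiple eigenvalue the one-sided derivatives are the eigenvalues of the compression of
    [T'] to the eigenspace, and the prescribed [beta j] need not be an eigenvector of that
    compression. Hence the first part asks that [rho j] be simple or that the contaminated
    eigenvectors converge to [beta j]. *)
Theorem theorem2 (R : realType) (K : nat) (K_ge2 : (2 <= K)%N)
  (E : 'I_K -> euclidType R)
  (d : measure_display) (Omega : measurableType d) (P : probability Omega R)
  (X : {mfun Omega >-> eprod E})
  (X_mean0 : forall k, vexp P (fun w => ecomp (X w) k) = 0)
  (X_L2 : forall k, (\int[P]_w (enorm (ecomp (X w) k) ^+ 2)%:E < +oo)%E)
  (X_cov1 : forall k, Vblock P X k k = \1%VF)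
  (rho : 'I_(\dim {:eprod E}) -> R)
  (beta : 'I_(\dim {:eprod E}) -> eprod E)
  (rho_noninc : forall i m : 'I_(\dim {:eprod E}),
     (i <= m)%N -> rho m <= rho i)
  (beta_orthonormal : forall i m : 'I_(\dim {:eprod E}),
     ip (beta i) (beta m) = (i == m)%:R)
  (beta_eigen : forall i : 'I_(\dim {:eprod E}),
     Top (law P X) (beta i) = rho i *: beta i)
  (B : 'I_(\dim {:eprod E}) -> probability (eprod E) R -> eprod E)
  (B_eigen : forall i : 'I_(\dim {:eprod E}),
     eigenvector_functional i (B i))
  (B_sign : forall (i : 'I_(\dim {:eprod E})) Q,
     admissible Q -> 0 <= ip (B i Q) (beta i))
  (B_law : forall i : 'I_(\dim {:eprod E}), B i (law P X) = beta i)
  (x : eprod E) (j : 'I_(\dim {:eprod E})) :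
  ((forall m, m != j -> rho m != rho j) \/
     enorm (B j (contamination (law P X) x e) - beta j) @[e --> 0^'+]
       --> (0 : R) ->
   is_IF_real x (R_fun j) (law P X)
     (\sum_(k < K) \sum_(l < K | l != k)
        ip (ecomp (beta j) k) (ecomp x k) *
        ip (ecomp x l - Vblock P X l k (ecomp x k)) (ecomp (beta j) l)))
  /\
  ((forall i m : 'I_(\dim {:eprod E}), (i < m)%N -> rho m < rho i) ->
   is_IF x (A_fun (B j)) (law P X)
     (\sum_(k < K) \sum_(l < K | l != k)
        \sum_(m < \dim {:eprod E} | m != j)
          ((rho j - rho m)^-1 *
           (ip (ecomp (beta m) k) (ecomp x k) *
              ip (ecomp x l) (ecomp (beta j) l)
            - 2^-1 * (ip (ecomp (beta m) k) (ecomp x k) *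
                ip (ecomp x k) (Vblock P X k l (ecomp (beta j) l)))
            - 2^-1 * (ip (ecomp x k) (Vblock P X k l (ecomp (beta m) l)) *
                ip (ecomp x k) (ecomp (beta j) k)))) *: beta m
      - 2^-1 *:
          (\sum_(k < K)
             ((tau_adj k \o tensor (ecomp x k) (ecomp x k) \o tau k)%VF
              + ip (ecomp (beta j) k) (ecomp x k) ^+ 2 *: \1%VF)
           - 2 *: \1%VF) (beta j))).
Proof.
set Q := contamination (law P X) x.
have gB : eigenbasis (Top (law P X)) beta rho by split.
have Q_adm e : 0 <= e < 1 -> admissible (Q e).
  exact: admissible_contaminated.
(* Both numbers are eigenvalues for the same nonzero vector, since [B j (law P X) = beta j]. *)
have R_law : R_fun j (law P X) = rho j.
  have [Tb _] := B_eigen j _ (admissible_law X_mean0 X_L2 X_cov1).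
  apply/eqP; rewrite -subr_eq0; have := eigenbasis_neq0 gB j; apply: contraNT => rj.
  move: Tb; rewrite B_law beta_eigen => /eqP; rewrite -subr_eq0 -scalerBl scaler_eq0.
  by rewrite -oppr_eq0 opprB (negbTE rj).
pose r e := R_fun j (Q e); pose b e := B j (Q e).
have T_b : \forall e \near (0 : R)^'+, Top (Q e) (b e) = r e *: b e.
  by apply: filterS near_right01 => e /Q_adm/(B_eigen j _)[].
have D_b : \forall e \near (0 : R)^'+, ip (b e) (fdiag (cov (Q e)) (b e)) = 1.
  by apply: filterS near_right01 => e /Q_adm/(B_eigen j _)[].
have dT : ocvg (0 : R)^'+ (fun e => e^-1 *: (Top (Q e) - Top (law P X)))
    (Top_derivative P X x).
  by rewrite Top_law //; exact: Top_contaminated_derivative.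
have dD : ocvg (0 : R)^'+ (fun e => e^-1 *: (fdiag (cov (Q e)) - \1%VF))
    (blockop x (fun=> 1) - \1%VF) by exact: fdiag_cov_contaminated_derivative.
have r_cvg : r e @[e --> (0 : R)^'+] --> rho j.
  apply: (eigenvalue_cvg gB dT); apply: filterS near_right01 => e e01.
  by split=> //; exact: Top_contaminated_selfadjoint.
have b_cvg : (forall m, m != j -> rho m != rho j) -> vcvg (0 : R)^'+ b (beta j).
  move=> rho_simple; apply: (eigenvector_cvg gB dT dD T_b D_b rho_simple r_cvg).
  by apply: filterS near_right01 => e /Q_adm; exact: B_sign.
split=> [simple_or_cvg|rho_dec].
  have bj : vcvg (0 : R)^'+ b (beta j).
    by case: simple_or_cvg => [/b_cvg//|b_cvg']; apply/vcvg_enorm.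
  have := eigenvalue_derivative gB dT T_b bj.
  rewrite /is_IF_real R_law ip_Top_derivative //.
  congr (_ --> _); apply: eq_bigr => k _; apply: eq_bigr => l _.
  (* On the diagonal [u = v = beta j] the two half terms coincide and add up to the single
     covariance term. *)
  rewrite ipBl mulrBr (Vblock_adj X_mean0 X_L2) (ipC (ecomp x k) (ecomp (beta j) k)).
  by field.
have rho_simple m : m != j -> rho m != rho j.
  by rewrite neq_ltn => /orP[/rho_dec/gt_eqF->|/rho_dec/lt_eqF->].
have bj := b_cvg rho_simple.
rewrite /is_IF; apply/vcvg_enorm.
have A_law : A_fun (B j) (law P X) = beta j.
  by rewrite /A_fun invsqrt_law // id_lfunE B_law.
rewrite A_law.
have db := eigenvector_derivative gB dT dD T_b D_b rho_simple r_cvg bj.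
(* Product rule for [S e (b e)]: [S b - beta = (S - 1) b + (b - beta)]. *)
pose A' e := (e^-1 *: (contaminated_root x e - \1%VF)) (b e) + e^-1 *: (b e - beta j).
have A'E : \forall e \near (0 : R)^'+, A' e = e^-1 *: (A_fun (B j) (Q e) - beta j).
  apply: filterS near_right01 => e e01; rewrite /A' /A_fun invsqrt_contaminated_law //.
  move: (contaminated_root x e) => S.
  by rewrite scale_lfunE add_lfunE opp_lfunE id_lfunE -scalerDr addrA subrK.
have dS := @contaminated_root_derivative R K E x.
apply: near_vcvg A'E _.
rewrite [X in vcvg _ _ X](_ : _ = (2^-1 *: (\1 - blockop x (fun=> 1%R)))%VF (beta j) +
  (\sum_(m | m != j) ((rho j - rho m)^-1 * ip (Top_derivative P X x (beta j)) (beta m)) *: beta m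
   - (2^-1 * ip ((blockop x (fun=> 1%R) - \1)%VF (beta j)) (beta j)) *: beta j)).
  by apply: vcvgD db; exact: ocvg_app dS bj.
have -> : \sum_(k < K) \sum_(l < K | l != k) \sum_(m < \dim {:eprod E} | m != j)
    ((rho j - rho m)^-1 *
      (ip (ecomp (beta m) k) (ecomp x k) * ip (ecomp x l) (ecomp (beta j) l)
       - 2^-1 * (ip (ecomp (beta m) k) (ecomp x k) *
           ip (ecomp x k) (Vblock P X k l (ecomp (beta j) l)))
       - 2^-1 * (ip (ecomp x k) (Vblock P X k l (ecomp (beta m) l)) *
           ip (ecomp x k) (ecomp (beta j) k)))) *: beta m =
  \sum_(m | m != j) ((rho j - rho m)^-1 *
     ip (Top_derivative P X x (beta j)) (beta m)) *: beta m.
  under eq_bigr => k _ do rewrite exchange_big /=.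
  rewrite exchange_big /=; apply: eq_bigr => m mj.
  rewrite ip_Top_derivative // mulr_sumr scaler_suml; apply: eq_bigr => k _.
  by rewrite mulr_sumr scaler_suml.
(* What remains are the terms without the gap factors. The identity in the derivative of the root
   and the [- \1] in that of the normalisation each leave one half of [beta j]; together they
   account for [2 *: \1] under the factor [2^-1]. *)
rewrite addrCA; congr (_ + _).
rewrite !(scale_lfunE, add_lfunE, opp_lfunE, id_lfunE, ipBl) beta_orthonormal eqxx.
have -> : (\sum_(k < K) ((tau_adj k \o tensor (ecomp x k) (ecomp x k) \o tau k)%VF
    + ip (ecomp (beta j) k) (ecomp x k) ^+ 2 *: \1%VF)) (beta j) =
  blockop x (fun=> 1) (beta j) + ip (blockop x (fun=> 1) (beta j)) (beta j) *: beta j.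
  rewrite big_split add_lfunE /=; congr (_ + _).
    by rewrite /blockop; congr (fun_of_lfun _ _); apply: eq_bigr => k _; rewrite scale1r.
  rewrite -scaler_suml scale_lfunE id_lfunE ip_blockop; congr (_ *: _).
  by apply: eq_bigr => k _; rewrite mul1r -expr2 ipC.
rewrite mulrBr mulr1 scalerBl !scalerBr scalerDr !scalerA mulVf ?pnatr_eq0 // scale1r.
rewrite !opprB addrACA -scalerDl -opprD.
by have -> : 2^-1 + 2^-1 = 1 :> R; [field | rewrite scale1r].
Qed.
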